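(* Let $G$ be a finite group and $P$ a $p$-subgroup of $G$. Let $M=S(G,P)$ and suppose that the fusion system $\mathcal{F}_P(G)$ is saturated. Then the following are equivalent: (1) $M$ is Brauer indecomposable. (2) For every subgroup $Q$ with $\mathrm{core}_G(P)\le Q\le P$ which is fully normalized in $\mathcal{F}_P(G)$, the module $\mathrm{Res}^{N_G(Q)}_{Q C_G(Q)} S(N_G(Q), N_P(Q))$ is indecomposable.
   Context: Throughout, $p$ is a prime and $k$ is an algebraically closed field of characteristic $p$; all modules are finite dimensional. For a finite group $G$ and a subgroup $H\le G$, $S(G,H)$ denotes the Scott module: the unique indecomposable direct summand of $\mathrm{Ind}_H^G(k)$ (with $k$ the trivial module) containing the trivial $kG$-module in its socle (equivalently, in its head). For a $kG$-module $M$ and a $p$-subgroup $Q\le G$, the Brauer construction is $M(Q)=M^Q/\sum_{R<Q}\mathrm{Tr}_R^Q(M^R)$, where $M^Q$ is the set of $Q$-fixed points and $\mathrm{Tr}_R^Q(m)=\sum_{x\in[Q/R]}xm$; it is a $kN_G(Q)$-module. $M$ is called Brauer indecomposable if for every $p$-subgroup $Q\le G$, $\mathrm{Res}^{N_G(Q)}_{QC_G(Q)} M(Q)$ is either indecomposable or zero. $\mathrm{core}_G(P)=\bigcap_{x\in G} xPx^{-1}$ is the largest normal subgroup of $G$ contained in $P$. The fusion system $\mathcal{F}_P(G)$ is the category whose objects are subgroups of $P$ and whose morphisms $Q\to R$ are the group homomorphisms induced by conjugation by elements of $G$; ''saturated'' is in the standard sense of saturated fusion systems (Broto–Levi–Oliver/Puig).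 A subgroup $Q\le P$ is fully normalized in $\mathcal{F}_P(G)$ if $|N_P(Q)|\ge |N_P(gQg^{-1})|$ for every $g\in G$ with $gQg^{-1}\le P$. *)

(* Defs.v *)
From HB Require Import structures.
From mathcomp Require Import all_boot all_order all_algebra all_fingroup all_solvable.
From mathcomp Require Import mxrepresentation.
Set Implicit Arguments. Unset Strict Implicit. Unset Printing Implicit Defensive.
Import GRing.Theory.
Local Open Scope ring_scope.

Section PermModule.
Variables (F : fieldType) (gT : finGroupType) (G H : {group gT}).

Definition cosetsHG := rcosets H G.
Definition ind_dim := #|cosetsHG|.

(* Matrix of x acting (on the right) on the permutation module k[H\G],
   basis vector of the coset C goes to that of C x. *)
Definition ind_triv_mx (x : gT) : 'M[F]_ind_dim :=
  \matrix_(i, j) ((@enum_val _ (mem cosetsHG) j ==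
                   @enum_val _ (mem cosetsHG) i :* x)%g%:R).

Lemma ind_triv_mx_repr : mx_repr G ind_triv_mx.
Proof.
split.
  apply/matrixP=> i j; rewrite !mxE rcoset1 (inj_eq enum_val_inj) eq_sym.
  by [].
move=> x y Gx Gy; apply/matrixP=> i j; rewrite !mxE.
set vi := @enum_val _ (mem cosetsHG) i.
have vix : (vi :* x)%g \in cosetsHG.
  have := @enum_valP _ (mem cosetsHG) i; rewrite -/vi.
  case/rcosetsP=> g Gg ->; rewrite -rcosetM.
  by apply/rcosetsP; exists (g * x)%g; rewrite ?groupM.
rewrite (bigD1 (enum_rank_in vix (vi :* x)%g)) //= big1 ?addr0.
  rewrite !mxE.
  have -> : @enum_val _ (mem cosetsHG) (enum_rank_in vix (vi :* x)%g) = (vi :* x)%g.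
    exact: enum_rankK_in.
  by rewrite eqxx mul1r rcosetM.
move=> k nk; rewrite !mxE.
case: eqP => [ek|]; last by rewrite mul0r.
case/eqP: nk; apply: enum_val_inj; rewrite ek.
by symmetry; apply: enum_rankK_in.
Qed.

Definition ind_triv_repr := MxRepresentation ind_triv_mx_repr.
End PermModule.

(* Modules are matrix representations over F acting on row vectors,   *)
(* i.e. right modules (x acts by v |-> v *m rM x).                     *)
Section Modules.
Local Open Scope group_scope.
Variables (F : fieldType) (gT : finGroupType).

Definition mx_stable n (rM : gT -> 'M[F]_n) (K : {set gT}) (A : 'M[F]_n) : Prop :=
  forall x, x \in K -> (A *m rM x <= A)%MS.

(* The section V/W (with W <= V submodules for K) is indecomposable or zero:
   whenever V/W = A/W (+) B/W with A, B K-submodules between W and V,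
   one of the summands is zero. *)
Definition section_indec_or_zero n (rM : gT -> 'M[F]_n) (K : {set gT})
    (V W : 'M[F]_n) : Prop :=
  forall A B : 'M[F]_n,
    mx_stable rM K A -> mx_stable rM K B ->
    (W <= A)%MS -> (W <= B)%MS -> (A <= V)%MS -> (B <= V)%MS ->
    (A + B == V)%MS -> (A :&: B == W)%MS ->
    (A == W)%MS \/ (B == W)%MS.

Definition mx_indecomposable n (rM : gT -> 'M[F]_n) (K : {set gT}) : Prop :=
  (0 < n)%N /\ section_indec_or_zero rM K 1%:M%R 0%R.

(* Scott module S(G,H): an indecomposable direct summand of Ind_H^G(F)
   (realised as the permutation module on the right cosets of H in G)
   containing the trivial module in its socle (i.e. having a nonzero
   G-fixed vector). rM is (isomorphic to) such a module. *)
Definition is_scott (G H : {group gT}) n (rM : mx_representation F G n) : Prop :=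
  [/\ mx_indecomposable rM G,
      exists2 v : 'rV[F]_n, v != 0%R & forall x, x \in G -> v *m rM x = v
    & exists U W : 'M[F]_(ind_dim G H),
        [/\ mxmodule (ind_triv_repr F G H) U, mxmodule (ind_triv_repr F G H) W,
            (U + W == 1%:M%R)%MS, (U :&: W == (0%R : 'M[F]_(ind_dim G H)))%MS &
            exists f : 'M[F]_(n, ind_dim G H),
              [/\ row_free f, (f == U)%MS &
                  forall x, x \in G -> rM x *m f = f *m ind_triv_repr F G H x]]].

(* Brauer construction M(Q) = M^Q / sum_{R < Q} Tr_R^Q(M^R). *)
Definition rel_trace (G : {group gT}) n (rM : mx_representation F G n)
    (R Q : {set gT}) : 'M[F]_n :=
  \sum_(x in transversal (rcosets R Q) Q) rM x.

Definition brauer_ker (G : {group gT}) n (rM : mx_representation F G n)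
    (Q : {group gT}) : 'M[F]_n :=
  (\sum_(R : {group gT} | R \proper Q) (rfix_mx rM R *m rel_trace rM R Q))%MS.

Definition brauer_indecomposable (p : nat) (G : {group gT}) n
    (rM : mx_representation F G n) : Prop :=
  forall Q : {group gT}, Q \subset G -> p.-group Q ->
    section_indec_or_zero rM (Q * 'C_G(Q)) (rfix_mx rM Q) (brauer_ker rM Q).
End Modules.

(* The fusion system F_P(G): objects subgroups of P, morphisms Q -> R  *)
(* the maps c_g : x |-> x ^ g (g in G, Q :^ g \subset R).              *)
Section Fusion.
Local Open Scope group_scope.
Variable gT : finGroupType.
Implicit Types (G P : {group gT}) (Q : {set gT}).

Definition fully_normalized G P Q : Prop :=
  Q \subset P /\
  forall g, g \in G -> Q :^ g \subset P -> (#|'N_P(Q :^ g)| <= #|'N_P(Q)|)%N.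

Definition fully_centralized G P Q : Prop :=
  Q \subset P /\
  forall g, g \in G -> Q :^ g \subset P -> (#|'C_P(Q :^ g)| <= #|'C_P(Q)|)%N.

(* N_phi for phi = c_g : Q -> P : the y in N_P(Q) such that
   phi o c_y o phi^-1 (= c_(g^-1 y g) on Q^g) lies in Aut_P(Q^g). *)
Definition N_phi G P Q (g : gT) : {set gT} :=
  [set y in 'N_P(Q) | [exists u in 'N_P(Q :^ g),
                         [forall z in Q :^ g, z ^ (g^-1 * y * g) == z ^ u]]].

(* Saturation (Broto-Levi-Oliver) of F_P(G), where
   Aut_F(Q) = conj_aut Q @* N_G(Q) and Aut_P(Q) = conj_aut Q @* N_P(Q). *)
Definition saturated_FP (p : nat) G P : Prop :=
  (forall Q : {group gT}, fully_normalized G P Q ->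
     fully_centralized G P Q /\
     p.-Sylow(conj_aut Q @* 'N_G(Q)) (conj_aut Q @* 'N_P(Q))) /\
  (forall (Q : {group gT}) (g : gT), Q \subset P -> g \in G -> Q :^ g \subset P ->
     fully_centralized G P (Q :^ g) ->
     exists2 h, h \in G &
       N_phi G P Q g :^ h \subset P /\ (forall x, x \in Q -> x ^ h = x ^ g)).
End Fusion.

(* Main.v *)
(** Write [k\Omega] for the permutation module on the cosets of [P] and let [e]
    be the idempotent endomorphism cutting out [M = S(G,P)].  For a [p]-subgroup
    [Q], restricting a [Q]-invariant matrix to the [Q]-fixed points [\Omega^Q] is
    multiplicative in characteristic [p], since the non-fixed points fall into
    orbits of size divisible by [p]; hence [M(Q)] is the image of the restricted
    idempotent [f], and everything can be read off from idempotent matrices.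

    The sum of all points of [\Omega] is fixed by [e], so the columns of [e] sum
    to [1], and so do those of each [f] with [Q <= P].  When [Q] is fully
    normalized, looking at the column of the base point and at the orbits of
    [N_G(Q)] on [\Omega^Q] produces [N_G(Q)]-maps from [S = S(N_G(Q), N_P(Q))] to
    [M(Q)] and back whose composite is not nilpotent, so [S] is a direct summand
    of [M(Q)] by Fitting's lemma.  This gives (1) => (2).

    For (2) => (1), argue by descending induction on [|Q|].  Since [core_G(P)] acts
    trivially one may enlarge [Q] to contain it, and one may replace [Q] by a
    fully normalized conjugate.  Write [f = f1 + f2] with [f1] cutting out [S], and
    suppose [f2 <> 0].  If [f2] does not vanish on the fixed points of some
    [p]-subgroup [R > Q] of [N_G(Q)], saturation moves [R] into [N_P(Q)], and
    [f1], [f2] split [M(R)], against the induction hypothesis.  Otherwise [f2] is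
    supported on pairs of points whose stabilizer is exactly [Q], so it lifts to a
    [G]-endomorphism of [M], which is not nilpotent, hence invertible; then
    [f2 = f] and [S = 0]. *)
Require Import Defs.
From HB Require Import structures.
From mathcomp Require Import all_boot all_order all_algebra all_fingroup all_solvable.
From mathcomp Require Import mxrepresentation.
From Stdlib Require Import Classical_Prop.
Set Implicit Arguments. Unset Strict Implicit. Unset Printing Implicit Defensive.

(** * Module decompositions expressed by idempotent matrices *)

Section Idempotents.
Import GRing.Theory.
Local Open Scope ring_scope.
Variables (F : fieldType) (gT : finGroupType).
Implicit Types (K : {set gT}).

Definition hom_mx K n m (r : gT -> 'M[F]_n) (s : gT -> 'M[F]_m)
    (X : 'M[F]_(n, m)) : Prop :=
  forall x, x \in K -> r x *m X = X *m s x.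

Lemma hom_mxM K n m l (r : gT -> 'M[F]_n) (s : gT -> 'M[F]_m)
    (t : gT -> 'M[F]_l) X Y :
  hom_mx K r s X -> hom_mx K s t Y -> hom_mx K r t (X *m Y).
Proof. by move=> hX hY x Kx; rewrite mulmxA hX // -mulmxA hY // mulmxA. Qed.

Lemma hom_mxB K n m (r : gT -> 'M[F]_n) (s : gT -> 'M[F]_m) X Y :
  hom_mx K r s X -> hom_mx K r s Y -> hom_mx K r s (X - Y).
Proof. by move=> hX hY x Kx; rewrite mulmxBr mulmxBl hX // hY. Qed.

Lemma hom_mx1 K n (r : gT -> 'M[F]_n) : hom_mx K r r 1%:M.
Proof. by move=> x Kx; rewrite mulmx1 mul1mx. Qed.

Lemma hom_mxS K K' n m (r : gT -> 'M[F]_n) (s : gT -> 'M[F]_m) X :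
  K' \subset K -> hom_mx K r s X -> hom_mx K' r s X.
Proof. by move=> /subsetP sK hX x Kx; rewrite hX // sK. Qed.

Lemma hom_mxV K n (r : gT -> 'M[F]_n) X :
  X \in unitmx -> hom_mx K r r X -> hom_mx K r r (invmx X).
Proof.
move=> uX hX x Kx.
by rewrite -{1}(mulKmx uX (r x *m invmx X)) (mulmxA X) -hX // mulmxK.
Qed.

(** For an idempotent [K]-endomorphism [f], this says that [f] is primitive or zero among the
    [K]-endomorphisms. The zero case is kept to match [indecomposable or zero] for Brauer
    quotients. *)
Definition idem_prim K n (r : gT -> 'M[F]_n) (f : 'M[F]_n) : Prop :=
  forall c, c *m c = c -> c *m f = c -> f *m c = c -> hom_mx K r r c ->
    c = 0 \/ c = f.

(** An idempotent [c] below [f] splits the row space of [f] into those of [c] and [f - c].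
    Conversely a splitting into [A] and [B] yields [f] followed by the projection onto [A] along
    [B]. *)
Lemma idem_primP K n (r : gT -> 'M[F]_n) (f : 'M[F]_n) :
  f *m f = f -> hom_mx K r r f ->
  (section_indec_or_zero r K f 0 <-> idem_prim K r f).
Proof.
move=> ff hf; split=> [H c cc cf fc hc | H A B sA sB _ _ lA lB eqf eq0].
  have hB := hom_mxB hf hc.
  have fB : (f - c) *m f = f - c by rewrite mulmxBl ff cf.
  case: (H c (f - c)); rewrite ?sub0mx //.
  - by move=> x Kx; rewrite -hc // submxMl.
  - by move=> x Kx; rewrite -hB // submxMl.
  - by rewrite -cf submxMl.
  - by rewrite -fB submxMl.
  - apply/andP; split.
      by rewrite addsmx_sub -{1}cf -fB !submxMl.
    by rewrite -{1}(addrNK c f) addrC addmx_sub_adds.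
  - rewrite andbT; apply/rV_subP=> v; rewrite sub_capmx => /andP[].
    case/submxP=> a ->; case/submxP=> b eqb.
    suff -> : a *m c = 0 by rewrite sub0mx.
    by rewrite -cc mulmxA eqb -mulmxA mulmxBl fc cc subrr mulmx0.
  - by rewrite andbT submx0 => /eqP->; left.
  - by rewrite andbT submx0 subr_eq0 => /eqP->; right.
have dAB : (A :&: B = 0)%MS.
  by apply/eqP; rewrite -submx0; case/andP: eq0.
have Af : A *m f = A by case/submxP: lA => a ->; rewrite -mulmxA ff.
have Bf : B *m f = B by case/submxP: lB => a ->; rewrite -mulmxA ff.
pose c := f *m proj_mx A B.
have lfAB : (f <= A + B)%MS by case/andP: eqf.
have cA : (c <= A)%MS by rewrite proj_mx_sub.
have cf : c *m f = c by case/submxP: cA => a ea; rewrite {1}ea -mulmxA Af -ea.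
have Ac : A *m c = A by rewrite /c mulmxA Af proj_mx_id.
have Bc : B *m c = 0 by rewrite /c mulmxA Bf proj_mx_0.
have cc : c *m c = c by case/submxP: cA => a ea; rewrite {1}ea -mulmxA Ac -ea.
have fc : f *m c = c by rewrite /c mulmxA ff.
have hc : hom_mx K r r c.
  move=> x Kx; rewrite /c mulmxA hf //.
  rewrite -{1}(add_proj_mx dAB lfAB) mulmxDl mulmxDl.
  have lA' : (f *m proj_mx A B *m r x <= A)%MS.
    by apply: submx_trans (sA x Kx); rewrite submxMr ?proj_mx_sub.
  have lB' : (f *m proj_mx B A *m r x <= B)%MS.
    by apply: submx_trans (sB x Kx); rewrite submxMr ?proj_mx_sub.
  by rewrite (proj_mx_id dAB lA') (proj_mx_0 dAB lB') addr0.
case: (H c cc cf fc hc) => ec.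
  by left; rewrite -Ac ec mulmx0 submx_refl.
by right; rewrite -Bf -ec Bc submx_refl.
Qed.

(** Fitting's lemma. Splitting the characteristic polynomial into a power of ['X] and a factor prime
    to ['X] gives, by Bezout, an idempotent polynomial in [y], which indecomposability forces to be
    0 or 1. *)
Lemma indec_fitting K n (r : gT -> 'M[F]_n) y :
  mx_indecomposable r K -> hom_mx K r r y ->
  y \in unitmx \/ exists k, y ^+ k = 0.
Proof.
case; case: n r y => // n r y _ /(idem_primP (mulmx1 _) (hom_mx1 r)) H hy.
have hyp (q : {poly F}) : hom_mx K r r (horner_mx y q).
  move=> x Kx; symmetry.
  by apply: (@comm_horner_mx _ _ y (r x)); rewrite /comm_mx hy.
have ch0 : char_poly y != 0 by rewrite monic_neq0 ?char_poly_monic.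
have [k [q]] := multiplicity_XsubC (char_poly y) 0.
rewrite ch0 /= subr0 => q0 def.
(* The exponent is raised by one so that it is positive: [y] is then a factor of [y ^+ K1], and the
   case [c = 1] exhibits a left inverse of [y]. *)
pose K1 := k.+1.
have {}def : q * 'X^K1 = char_poly y * 'X by rewrite def exprSr mulrA.
have /Bezout_eq1_coprimepP[[u v] /= uv] : coprimep q 'X^K1.
  by rewrite coprimep_expr // coprimepX.
have yk : horner_mx y ('X^K1) = y ^+ K1 by rewrite rmorphXn /= horner_mx_X.
pose c := horner_mx y (v * 'X^K1).
have c1 : c = 1 - horner_mx y (u * q).
  by rewrite -(rmorph1 (horner_mx y)) -uv rmorphD /= addrAC subrr add0r.
have qk : horner_mx y q * y ^+ K1 = 0.
  by rewrite -yk -rmorphM def rmorphM /= Cayley_Hamilton mul0r.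
have cc : c *m c = c.
  rewrite -[c *m c]/(c * c) {2}c1 mulrBr mulr1 /c -rmorphM /= mulrACA.
  by rewrite ['X^_ * q]mulrC def !rmorphM /= Cayley_Hamilton mul0r mulr0 subr0.
case: (H c cc (mulmx1 _) (mul1mx _) (hyp _)) => ec; [right|left].
  exists K1; rewrite -[y ^+ K1]mul1r -[1](subrK (horner_mx y (u * q))) -c1 ec add0r.
  by rewrite rmorphM /= -mulrA qk mulr0.
move: ec; rewrite /c rmorphM /= yk exprSr mulrA => ec.
by have [] := mulmx1_unit ec.
Qed.

(** An idempotent [c] below [g] is transported to [be *m c *m al] below [f], and [c] is recovered
    from it; so primitivity passes to direct summands. *)
Lemma idem_prim_summand K m d (s : gT -> 'M[F]_m) (r : gT -> 'M[F]_d) g f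
    (al : 'M[F]_(m, d)) (be : 'M[F]_(d, m)) :
  hom_mx K s r al -> hom_mx K r s be -> al *m be = g ->
  al *m f = al -> f *m be = be ->
  idem_prim K r f -> idem_prim K s g.
Proof.
move=> ha hb ab af fb H c cc cg gc hc.
have back : al *m (be *m c *m al) *m be = c.
  by rewrite !mulmxA ab gc -mulmxA ab.
case: (H (be *m c *m al)).
- by rewrite !mulmxA -(mulmxA _ al be) ab -(mulmxA _ c g) cg -(mulmxA _ c c) cc.
- by rewrite -!mulmxA af.
- by rewrite !mulmxA fb.
- by apply: hom_mxM ha; apply: hom_mxM hc.
- by move=> e0; left; rewrite -back e0 mulmx0 mul0mx.
- by move=> ef; right; rewrite -back ef af ab.
Qed.

(** The map [phi] induces a [K]-isomorphism from [V/W] onto the row space of [E]. Summands are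
    pulled back by preimages inside [V] and pushed forward by images. *)
Lemma section_transfer K n d (r : gT -> 'M[F]_n) (r' : gT -> 'M[F]_d)
    (V W : 'M[F]_n) (E : 'M[F]_d) (phi : 'M[F]_(n, d)) :
  mx_stable r K V -> (W <= V)%MS -> (V *m phi :=: E)%MS ->
  (forall u : 'rV_n, (u <= V)%MS -> (u *m phi == 0) = (u <= W)%MS) ->
  (forall x, x \in K -> V *m r x *m phi = V *m phi *m r' x) ->
  (section_indec_or_zero r K V W <-> section_indec_or_zero r' K E 0).
Proof.
move=> sV lWV VE kerW hphi.
have hu x (u : 'rV_n) : x \in K -> (u <= V)%MS -> u *m r x *m phi = u *m phi *m r' x.
  by move=> Kx /submxP[a ->]; rewrite -!mulmxA !(mulmxA V) hphi // !mulmxA.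
have W0 : W *m phi = 0.
  apply/row_matrixP=> i; rewrite row_mul row0; apply/eqP.
  by rewrite kerW ?row_sub // (submx_trans (row_sub i W)).
split=> H A B sA sB lWA lWB lAV lBV eAB iAB.
  pose pre (X : 'M_d) := (V :&: kermx (phi *m cokermx X))%MS.
  have preP X (u : 'rV_n) : (u <= pre X)%MS = (u <= V)%MS && (u *m phi <= X)%MS.
    by rewrite sub_capmx sub_kermx mulmxA -submxE.
  have lift (u : 'rV_d) : (u <= E)%MS -> exists2 v : 'rV_n, (v <= V)%MS & v *m phi = u.
    by rewrite -VE => /submxP[a ->]; exists (a *m V); rewrite ?submxMl ?mulmxA.
  have pre_stable X : mx_stable r' K X -> mx_stable r K (pre X).
    move=> sX x Kx; apply/rV_subP=> u /submxP[a ->].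
    rewrite mulmxA; move: (a *m pre X) (submxMl a (pre X)) => {}u.
    rewrite !preP => /andP[uV uX]; rewrite hu //.
    rewrite (submx_trans _ (sV x Kx)) ?submxMr //=.
    by rewrite (submx_trans _ (sX x Kx)) ?submxMr.
  have preW X : (W <= pre X)%MS.
    apply/rV_subP=> u uW; rewrite preP (submx_trans uW) //=.
    by case/submxP: uW => a ->; rewrite -mulmxA W0 mulmx0 sub0mx.
  have pre0 X : (X <= E)%MS -> (pre X == W)%MS -> (X == (0 : 'M_d))%MS.
    move=> XE /andP[XW _]; rewrite sub0mx andbT; apply/rV_subP=> u uX.
    have [v vV def] := lift u (submx_trans uX XE).
    have : (v <= pre X)%MS by rewrite preP vV def.
    by move/submx_trans/(_ XW); rewrite -kerW // -def => /eqP->; rewrite sub0mx.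
  have := H (pre A) (pre B) (pre_stable _ sA) (pre_stable _ sB).
  case; rewrite ?preW ?capmxSl //.
  - rewrite addsmx_sub !capmxSl /=; apply/row_subP=> i.
    move: (row i V) (row_sub i V) => v vV.
    have: (v *m phi <= A + B)%MS.
      by rewrite (eqmxP eAB) -VE submxMr.
    case/sub_addsmxP=> [[a b]] /= eab.
    have [v1 v1V e1] := lift (a *m A) (submx_trans (submxMl _ _) lAV).
    rewrite -(subrK v1 v) addrC addmx_sub_adds // preP ?v1V ?e1 ?submxMl //.
    by rewrite addmx_sub ?eqmx_opp //= mulmxBl eab e1 addrAC subrr add0r submxMl.
  - apply/andP; split; last by rewrite sub_capmx !preW.
    apply/rV_subP=> v.
    rewrite sub_capmx !preP => /andP[/andP[vV vA] /andP[_ vB]].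
    rewrite -kerW // -submx0; case/andP: iAB => [l0 _].
    by apply: submx_trans l0; rewrite sub_capmx vA.
  - by rewrite andbT => e; left; rewrite pre0 ?e ?preW.
  - by rewrite andbT => e; right; rewrite pre0 ?e ?preW.
have img X : (X <= V)%MS -> (X *m phi <= E)%MS by rewrite -VE => /submxMr.
have st X : (X <= V)%MS -> mx_stable r K X -> mx_stable r' K <<X *m phi>>%MS.
  move=> XV sX x Kx; rewrite (eqmxMr _ (genmxE _)) genmxE.
  apply/row_subP=> i; rewrite row_mul row_mul -hu //; last first.
    by rewrite (submx_trans (row_sub i X)).
  by rewrite submxMr // (submx_trans _ (sX x Kx)) // submxMr ?row_sub.
have back X : (W <= X)%MS -> (X <= V)%MS -> (X *m phi <= (0 : 'M_d))%MS -> (X == W)%MS.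
  move=> WX XV X0; rewrite WX andbT; apply/rV_subP=> u uX.
  by rewrite -kerW ?(submx_trans uX) // -submx0 (submx_trans _ X0) // submxMr.
have := H _ _ (st A lAV sA) (st B lBV sB).
case; rewrite ?sub0mx ?genmxE ?img //.
- apply/eqmxP; apply: eqmx_trans VE.
  apply: eqmx_trans (adds_eqmx (genmxE _) (genmxE _)) _.
  apply: eqmx_trans (eqmx_sym (addsmxMr _ _ _)) _.
  by apply: eqmxMr; apply/eqmxP.
- rewrite andbT; apply/rV_subP=> u; rewrite sub_capmx !genmxE.
  case/andP=> /submxP[a ->] /submxP[b]; rewrite !mulmxA => e.
  have aV : (a *m A <= V)%MS by rewrite mulmx_sub.
  have bV : (b *m B <= V)%MS by rewrite mulmx_sub.
  have : (a *m A - b *m B <= W)%MS.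
    by rewrite -kerW ?addmx_sub ?eqmx_opp // mulmxBl e subrr.
  move/submx_trans/(_ lWB) => dB.
  have aB : (a *m A <= B)%MS.
    by rewrite -(subrK (b *m B) (a *m A)) addmx_sub // submxMl.
  have: (a *m A <= W)%MS.
    by case/andP: iAB => iAB _; rewrite (submx_trans _ iAB) // sub_capmx submxMl.
  by rewrite -kerW // => /eqP->; rewrite sub0mx.
- by rewrite andbT => e; left; apply: back.
- by rewrite andbT => e; right; apply: back.
Qed.
End Idempotents.

(** * Permutation matrices, fixed points and the Brauer morphism *)

Section PermRep.
Import GRing.Theory.
Local Open Scope ring_scope.
Variables (F : fieldType) (p : nat) (gT : finGroupType).

Definition perm_rep (G : {group gT}) d (to : action G 'I_d) (x : gT) : 'M[F]_d :=
  \matrix_(i, j) (j == to i x)%:R.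

(** Multiplying by this diagonal projection on both sides restricts a matrix to the [Q]-fixed points
    while keeping the full index set. *)
Definition fix_mx (G : {group gT}) d (to : action G 'I_d) (Q : {set gT}) : 'M[F]_d :=
  diag_mx (\row_i (i \in afix to Q)%:R).

Lemma mul_perm_rep (G : {group gT}) d (to : action G 'I_d) m (X : 'M_(d, m)) x i j :
  (perm_rep to x *m X) i j = X (to i x) j.
Proof.
rewrite mxE (bigD1 (to i x)) //= big1 ?addr0 => [|k nk]; rewrite mxE ?eqxx ?mul1r //.
by rewrite (negPf nk) mul0r.
Qed.

Lemma mul_perm_repr (G : {group gT}) d (to : action G 'I_d) m (X : 'M_(m, d)) x i j :
  (X *m perm_rep to x) i (to j x) = X i j.
Proof.
rewrite mxE (bigD1 j) //= big1 ?addr0 => [|k nk]; rewrite mxE ?eqxx ?mulr1 //.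
by rewrite (inj_eq (act_inj to x)) eq_sym (negPf nk) mulr0.
Qed.

Lemma hom_perm_repP (G G' : {group gT}) (K : {set gT}) d d'
    (to : action G 'I_d) (to' : action G' 'I_d') X : K \subset G' ->
  (hom_mx K (perm_rep to) (perm_rep to') X <->
   forall x i j, x \in K -> X (to i x) (to' j x) = X i j).
Proof.
move=> sKG; split=> [hX x i j Kx | hX x Kx].
  by rewrite -mul_perm_rep hX // mul_perm_repr.
apply/matrixP=> i j; have Gx := subsetP sKG x Kx.
by rewrite -(actKVin to' Gx j) mul_perm_repr mul_perm_rep hX.
Qed.

Section Fixed.
Variables (G : {group gT}) (d : nat) (to : action G 'I_d).
Implicit Types Q R : {group gT}.

Lemma mul_fix_mx m (X : 'M_(d, m)) (Q : {set gT}) i j :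
  (fix_mx to Q *m X) i j = if i \in afix to Q then X i j else 0.
Proof. by rewrite mul_diag_mx !mxE; case: ifP; rewrite ?mul1r ?mul0r. Qed.

Lemma mul_fix_mxr m (X : 'M_(m, d)) (Q : {set gT}) i j :
  (X *m fix_mx to Q) i j = if j \in afix to Q then X i j else 0.
Proof. by rewrite mul_mx_diag !mxE; case: ifP; rewrite ?mulr1 ?mulr0. Qed.

Lemma fix_mxS (Q R : {set gT}) : Q \subset R ->
  fix_mx to Q *m fix_mx to R = fix_mx to R.
Proof.
move=> sQR; apply/matrixP=> i j; rewrite mul_fix_mx; case: ifP => // nQ.
rewrite !mxE; case: eqP => // _; case: (boolP (i \in _)) => // iR.
by rewrite (subsetP (afixS to sQR) _ iR) in nQ.
Qed.

Lemma fix_mxSr (Q R : {set gT}) : Q \subset R ->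
  fix_mx to R *m fix_mx to Q = fix_mx to R.
Proof.
move=> sQR; apply/matrixP=> i j; rewrite mul_fix_mxr; case: ifP => // nQ.
rewrite !mxE; case: eqP => // e; case: (boolP (i \in _)) => // iR.
by rewrite -e (subsetP (afixS to sQR) _ iR) in nQ.
Qed.

Lemma fix_mx_idem (Q : {set gT}) : fix_mx to Q *m fix_mx to Q = fix_mx to Q.
Proof. exact: fix_mxS. Qed.

Lemma mem_afixJ Q x i : Q \subset G -> x \in G ->
  (to i x \in afix to (Q :^ x)%g) = (i \in afix to Q).
Proof.
move=> /subsetP sQG Gx.
have E y : y \in Q -> to (to i x) (y ^ x)%g = to (to i y) x.
  move=> /sQG Gy; rewrite -!(actMin to) ?groupJ //; congr (to _ _).
  by rewrite conjgE mulKVg.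
apply/afixP/afixP=> H y Qy; last first.
  by move: Qy; rewrite mem_conjg => Qy; rewrite -{1}(conjgKV x y) E // (H _ Qy).
by apply: (@act_inj _ _ _ to x); rewrite -E // H // memJ_conjg.
Qed.

Lemma perm_rep_fix_mx Q x : Q \subset G -> x \in G ->
  perm_rep to x *m fix_mx to (Q :^ x)%g = fix_mx to Q *m perm_rep to x.
Proof.
move=> sQG Gx; apply/matrixP=> i j; rewrite mul_perm_rep mul_fix_mx !mxE.
rewrite mem_afixJ // [j == _]eq_sym.
by case: eqP => _; case: ifP.
Qed.

Lemma hom_fix_mx Q : Q \subset G ->
  hom_mx ('N_G(Q))%g (perm_rep to) (perm_rep to) (fix_mx to Q).
Proof.
move=> sQG x /setIP[Gx /normP nQ]; by rewrite -perm_rep_fix_mx // nQ.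
Qed.

Lemma fix_mx_perm_rep Q x : Q \subset G -> x \in Q ->
  fix_mx to Q *m perm_rep to x = fix_mx to Q.
Proof.
move=> sQG Qx; apply/matrixP=> i j; rewrite mul_fix_mx !mxE.
case: ifP => [/afixP/(_ x Qx)->|]; first by rewrite eq_sym.
by case: eqP.
Qed.

Lemma perm_rep_fix_mxr Q x : Q \subset G -> x \in Q ->
  perm_rep to x *m fix_mx to Q = fix_mx to Q.
Proof.
move=> sQG Qx; rewrite hom_fix_mx ?fix_mx_perm_rep //.
by rewrite inE (subsetP sQG) // (subsetP (normG Q)).
Qed.

Hypothesis charF : p \in [pchar F].

(** On each orbit of non-fixed points [h] is constant and the orbit length is divisible by [p], so
    the orbit contributes 0. *)
Lemma sum_pgroup_fix Q (h : 'I_d -> F) : Q \subset G -> (p.-group Q)%g ->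
  (forall x k, x \in Q -> h (to k x) = h k) ->
  \sum_k h k = \sum_(k in afix to Q) h k.
Proof.
move=> sQG pQ hh; rewrite (bigID (mem (afix to Q))) /=.
rewrite [X in _ + X](partition_big (orbit to Q) predT) //= [X in _ + X]big1 ?addr0 //.
move=> O _; have [k0 /andP[nk0 /eqP <-]|no] :=
    pickP [pred k | (k \notin afix to Q) && (orbit to Q k == O)]; last first.
  by rewrite big_pred0.
rewrite (eq_bigl (mem (orbit to Q k0))) => [|k /=]; last first.
  apply/andP/idP=> [[_ /eqP/(orbit_in_eqP sQG)] // | kO].
  split; last by apply/eqP/(orbit_in_eqP sQG).
  apply: contra nk0 => /afixP fk; move: kO; rewrite (orbit_in_sym _ sQG).
  by case/orbitP=> x Qx; rewrite fk // => <-; apply/afixP.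
rewrite (eq_bigr (fun=> h k0)) => [|k /orbitP[x Qx <-]]; last exact: hh.
rewrite sumr_const -mulr_natr; apply/eqP; rewrite mulf_eq0 -(dvdn_pcharf charF).
rewrite card_orbit_in //; have pr := pcharf_prime charF; apply/orP; right.
apply: contraR nk0; rewrite -p'natE // => p'i.
have pi : p.-nat #|Q : 'C_Q[k0 | to]|%g by apply: pnat_dvd (dvdn_indexg _ _) pQ.
have /eqP := pnat_1 pi p'i; rewrite indexg_eq1 => sQ.
apply/afixP=> x Qx; have /setIP[_ cx] := subsetP sQ x Qx.
exact: astab_act cx (set11 k0).
Qed.

(** The terms [A i k * B k j] of a matrix product are [Q]-invariant in [k], so only fixed [k]
    contribute. *)
Lemma mulmx_pgroup_fix Q m l (A : 'M[F]_(m, d)) (B : 'M[F]_(d, l)) :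
  Q \subset G -> (p.-group Q)%g ->
  (forall x, x \in Q -> A *m perm_rep to x = A) ->
  (forall x, x \in Q -> perm_rep to x *m B = B) ->
  A *m B = A *m fix_mx to Q *m B.
Proof.
move=> sQG pQ hA hB; apply/matrixP=> i j; rewrite !mxE.
rewrite (@sum_pgroup_fix Q) // => [|x k Qx].
  rewrite big_mkcond; apply: eq_bigr => k _.
  by rewrite mul_fix_mxr; case: ifP; rewrite ?mul0r.
by rewrite -{1}(hA x Qx) mul_perm_repr -mul_perm_rep hB.
Qed.
End Fixed.

Section Brauer.
Hypothesis charF : p \in [pchar F].
Variables (G G' G'' Q : {group gT}) (d d' d'' : nat).
Variables (to : action G 'I_d) (to' : action G' 'I_d') (to'' : action G'' 'I_d'').
Hypotheses (sQG : Q \subset G) (sQG' : Q \subset G') (sQG'' : Q \subset G'').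
Hypothesis pQ : (p.-group Q)%g.

(* Multiplicativity of the Brauer morphism [X |-> fix_mx Q *m X *m fix_mx Q]. *)
Lemma brauer_mulmx X Y : hom_mx Q (perm_rep to) (perm_rep to') X ->
  hom_mx Q (perm_rep to') (perm_rep to'') Y ->
  fix_mx to Q *m (X *m Y) *m fix_mx to'' Q =
  (fix_mx to Q *m X *m fix_mx to' Q) *m (fix_mx to' Q *m Y *m fix_mx to'' Q).
Proof.
move=> hX hY; rewrite !mulmxA -(mulmxA _ (fix_mx to' Q) (fix_mx to' Q)) fix_mx_idem.
rewrite -!(mulmxA _ Y); rewrite -(mulmx_pgroup_fix charF) // => x Qx.
  by rewrite -mulmxA -hX // mulmxA fix_mx_perm_rep.
by rewrite mulmxA hY // -mulmxA perm_rep_fix_mxr.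
Qed.
End Brauer.
End PermRep.

(** * The action of [G] on the cosets of [H] *)

Section InducedAction.
Local Open Scope group_scope.
Variables (F : fieldType) (gT : finGroupType) (G H : {group gT}).

Definition ind_pt (i : 'I_(ind_dim G H)) : {set gT} :=
  @enum_val _ (mem (cosetsHG G H)) i.

(** Elements outside [G] act as the identity, because an [action] must be injective for every
    element of [gT]. *)
Definition ind_to (i : 'I_(ind_dim G H)) (x : gT) : 'I_(ind_dim G H) :=
  enum_rank_in (@enum_valP _ (mem (cosetsHG G H)) i)
    (if x \in G then ind_pt i :* x else ind_pt i).

Lemma ind_ptP i : ind_pt i \in rcosets H G.
Proof. exact: (@enum_valP _ (mem (cosetsHG G H)) i). Qed.

Lemma ind_pt_inj : injective ind_pt.
Proof. exact: enum_val_inj. Qed.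

Lemma ind_toE i x : ind_pt (ind_to i x) = if x \in G then ind_pt i :* x else ind_pt i.
Proof.
apply: enum_rankK_in; case: ifP => Gx; last exact: ind_ptP.
have /rcosetsP[g Gg ->] := ind_ptP i; rewrite -rcosetM.
by apply/rcosetsP; exists (g * x); rewrite ?groupM.
Qed.

Lemma ind_to_is_action : is_action G ind_to.
Proof.
split=> [x i j /(congr1 ind_pt)|i x y Gx Gy].
  rewrite !ind_toE; case: ifP => _ e; apply: ind_pt_inj => //.
  exact: can_inj (rcosetK x) _ _ e.
by apply: ind_pt_inj; rewrite !ind_toE groupM // Gx Gy rcosetM.
Qed.

Definition ind_act : action G 'I_(ind_dim G H) := Action ind_to_is_action.

Lemma ind_triv_mxE x : x \in G -> ind_triv_mx F G H x = perm_rep F ind_act x.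
Proof.
move=> Gx; apply/matrixP=> i j; rewrite !mxE -(inj_eq ind_pt_inj) /= ind_toE Gx.
by [].
Qed.

Lemma ind_base_mem : gval H \in rcosets H G.
Proof. by apply/rcosetsP; exists 1; rewrite ?group1 ?rcoset1. Qed.

Definition ind_base : 'I_(ind_dim G H) :=
  enum_rank_in (ind_base_mem : gval H \in mem (cosetsHG G H)) H.

Lemma ind_baseE : ind_pt ind_base = H.
Proof. by apply: enum_rankK_in; apply: ind_base_mem. Qed.

Lemma ind_act_base x : x \in G -> (ind_act ind_base x == ind_base) = (x \in H).
Proof.
move=> Gx; rewrite -(inj_eq ind_pt_inj) /= ind_toE Gx ind_baseE.
by apply/eqP/idP=> [<- | /rcoset_id //]; apply: rcoset_refl.
Qed.

Lemma ind_act_trans i : exists2 g, g \in G & i = ind_act ind_base g.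
Proof.
have /rcosetsP[g Gg e] := ind_ptP i; exists g => //.
by apply: ind_pt_inj; rewrite /= ind_toE Gg ind_baseE.
Qed.
End InducedAction.

(** * Scott modules as primitive idempotents fixing the all-one vector *)

Section Scott.
Import GRing.Theory.
Local Open Scope ring_scope.
Variables (F : fieldType) (gT : finGroupType) (G H : {group gT}).
Let d := ind_dim G H.
Let V := perm_rep F (ind_act G H).
Let sigma : 'rV[F]_d := const_mx 1.

Lemma perm_rep_const x : x \in G -> sigma *m V x = sigma.
Proof.
move=> Gx; apply/matrixP=> i j.
by rewrite -(actKVin (ind_act G H) Gx j) mul_perm_repr !mxE.
Qed.

Lemma ind_fixed_const (w : 'rV[F]_d) :
  (forall x, x \in G -> w *m V x = w) -> w = w 0 (ind_base G H) *: sigma.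
Proof.
move=> hw; apply/rowP=> j; rewrite !mxE mulr1.
have [g Gg ->] := ind_act_trans j.
by rewrite -[in LHS](hw g Gg) mul_perm_repr.
Qed.

Lemma ind_const_neq0 : sigma != 0.
Proof.
apply/eqP=> /rowP/(_ (ind_base G H)); rewrite !mxE => /eqP.
by rewrite oner_eq0.
Qed.

Lemma hom_ind_triv n (r : gT -> 'M[F]_n) X :
  (forall x, x \in G -> r x *m X = X *m ind_triv_repr F G H x) ->
  hom_mx G r V X.
Proof. by move=> h x Gx; rewrite h //= ind_triv_mxE. Qed.

(** This replaces the abstract module by an inclusion [io] and a retraction [rh]; the idempotent
    [rh *m io] fixes [sigma], which is how the trivial submodule enters all later arguments. *)
Lemma scott_split n (rM : mx_representation F G n) : is_scott H rM ->
  exists (io : 'M[F]_(n, d)) (rh : 'M[F]_(d, n)),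
    [/\ hom_mx G rM V io, hom_mx G V rM rh, io *m rh = 1%:M &
        sigma *m (rh *m io) = sigma].
Proof.
case=> _ [v v0 hv] [U [W [mU mW UW1 UW0 [io [fio eio hio]]]]].
have dUW : (U :&: W = 0)%MS by apply/eqP; rewrite -submx0; case/andP: UW0.
have oneUW (m : nat) (X : 'M_(m, d)) : (X <= U + W)%MS.
  by rewrite (submx_trans (submx1 X)) //; case/andP: UW1.
pose rh := proj_mx U W *m pinvmx io.
have ioU : (io <= U)%MS by case/andP: eio.
have Uio : (U <= io)%MS by case/andP: eio.
have hio' : hom_mx G rM V io by apply: hom_ind_triv.
have io1 : io *m rh = 1%:M by rewrite mulmxA proj_mx_id // mulmxVp.
have rhio : rh *m io = proj_mx U W.
  rewrite /rh -mulmxA -{1}[proj_mx U W]mul1mx mulmxA mulmxKpV ?mul1mx //.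
  by rewrite -[proj_mx U W]mul1mx (submx_trans (proj_mx_sub _ _ _)).
have PP' : proj_mx U W + proj_mx W U = 1%:M.
  by have := add_proj_mx dUW (oneUW _ 1%:M); rewrite !mul1mx.
have subP A B : (proj_mx A B <= A)%MS.
  by rewrite -[proj_mx A B]mul1mx proj_mx_sub.
have hproj : hom_mx G V V (proj_mx U W).
  move=> x Gx; rewrite -{1}[V x]mul1mx -PP' !mulmxDl.
  move/mxmoduleP/(_ x Gx): mU; move/mxmoduleP/(_ x Gx): mW.
  rewrite /= !ind_triv_mxE // => sW sU.
  rewrite (proj_mx_id dUW) ?(proj_mx_0 dUW) ?addr0 //.
    by apply: submx_trans sW; rewrite submxMr.
  by apply: submx_trans sU; rewrite submxMr.
exists io, rh; split=> //.
  move=> x Gx; rewrite -[LHS]mulmx1 -io1 mulmxA -(mulmxA (V x)) rhio hproj // -rhio.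
  by rewrite -(mulmxA rh) -hio' // -!mulmxA io1 mulmx1.
(* The image of the fixed vector [v] is [G]-fixed, hence a nonzero multiple of [sigma] by
   transitivity; so [sigma] lies in the summand. *)
have hw x : x \in G -> v *m io *m V x = v *m io.
  by move=> Gx; rewrite -mulmxA -hio' // mulmxA hv.
have := ind_fixed_const hw; set c := _ 0 _ => defw.
have c0 : c != 0.
  apply: contraNneq v0 => c0; rewrite -[v]mulmx1 -io1 mulmxA defw c0 scale0r.
  by rewrite mul0mx.
apply: (scalerI c0); rewrite scalemxAl -defw.
by rewrite mulmxA -(mulmxA v io rh) io1 mulmx1.
Qed.

Lemma idem_rank_lt (c s : 'M[F]_d) :
  s *m s = s -> c *m c = c -> c *m s = c -> s *m c = c -> c != s ->
  (\rank c < \rank s)%N.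
Proof.
move=> ss cc cs sc; apply: contraR; rewrite -leqNgt => le.
have : (c <= s)%MS by rewrite -cs submxMl.
move/(mxrank_leqif_sup)/geq_leqif; rewrite le => /esym/submxP[a e].
by rewrite -sc {1}e -mulmxA cc -e eqxx.
Qed.

(** Descent on the rank, starting from the identity: if [s] splits as [c] and [s - c], one of the
    two still fixes [sigma] and has smaller rank. *)
Lemma scott_idem_exists :
  exists s : 'M[F]_d, [/\ s *m s = s, hom_mx G V V s, sigma *m s = sigma &
                          idem_prim G V s].
Proof.
suff main r (s : 'M[F]_d) : (\rank s < r)%N -> s *m s = s -> hom_mx G V V s ->
    sigma *m s = sigma -> exists s : 'M[F]_d, [/\ s *m s = s, hom_mx G V V s,
      sigma *m s = sigma & idem_prim G V s].
  by apply: (main _ 1%:M (ltnSn _)); rewrite ?mulmx1 //; apply: hom_mx1.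
elim: r s => // r IH s ltr ss hs es; have [ps|nps] := classic (idem_prim G V s).
  by exists s.
have [c [cc cs sc hc [c0 cns]]] : exists c, [/\ c *m c = c, c *m s = c,
    s *m c = c, hom_mx G V V c & c != 0 /\ c != s].
  apply: NNPP => no; apply: nps => c cc cs sc hc.
  have [->|c0] := eqVneq c 0; first by left.
  have [->|c1] := eqVneq c s; first by right.
  by case: no; exists c.
have hfix x : x \in G -> sigma *m c *m V x = sigma *m c.
  by move=> Gx; rewrite -mulmxA -hc // mulmxA perm_rep_const.
have := ind_fixed_const hfix; set l := _ 0 _ => defl.
(* [c] multiplies [sigma] by a scalar [l], and idempotence of [c] leaves only [l = 0] or [l = 1]. *)
have : l * l == l.
  have : sigma *m c *m c = sigma *m c by rewrite -mulmxA cc.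
  rewrite defl -scalemxAl defl scalerA => /rowP/(_ (ind_base G H)).
  by rewrite !mxE !mulr1 => ->.
rewrite -subr_eq0 -{3}[l]mulr1 -mulrBr mulf_eq0 subr_eq0.
case/orP=> /eqP el; rewrite el ?scale0r ?scale1r in defl.
  have bb : (s - c) *m (s - c) = s - c.
    by rewrite mulmxBr !mulmxBl ss sc cs cc subrr subr0.
  apply: (IH (s - c)) => //; last by rewrite mulmxBr defl es subr0.
    rewrite -ltnS (leq_trans _ ltr) // ltnS idem_rank_lt //.
    - by rewrite mulmxBl ss cs.
    - by rewrite mulmxBr ss sc.
    by rewrite -subr_eq0 addrAC subrr add0r oppr_eq0.
  exact: hom_mxB.
by apply: (IH c); rewrite // -ltnS (leq_trans _ ltr) // ltnS idem_rank_lt.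
Qed.

Lemma idem_split (s : 'M[F]_d) : s *m s = s ->
  exists m (io : 'M[F]_(m, d)) (rh : 'M[F]_(d, m)),
    [/\ rh *m io = s, io *m rh = 1%:M & m = \rank s].
Proof.
move=> ss; exists (\rank s), (row_base s), (col_base s).
split=> //; first exact: mulmx_base.
have fr := row_base_free s; have fc := col_base_full s.
have := mulmx_base s; move: (row_base s) (col_base s) fr fc => io rh fr fc e.
apply: (row_full_inj fc); apply: (row_free_inj fr).
by rewrite mulmx1 (mulmxA rh io rh) -(mulmxA _ rh io) e ss.
Qed.

(** Condition (2) quantifies over all realisations of the Scott module, so using it as a hypothesis
    requires one to exist. It is the rank factorization of the idempotent just found. *)
Lemma scott_exists : exists m (rS : mx_representation F G m), is_scott H rS.
Proof.
have [s [ss hs es ps]] := scott_idem_exists.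
have [m [io [rh [rhio io1 em]]]] := idem_split ss.
have ios : io *m s = io by rewrite -rhio mulmxA io1 mul1mx.
have srh : s *m rh = rh by rewrite -rhio -mulmxA io1 mulmx1.
pose rS x := io *m V x *m rh.
have VG x : x \in G -> ind_triv_mx F G H x = V x by apply: ind_triv_mxE.
have Vs x : x \in G -> V x *m s = s *m V x by apply: hs.
have [V1 VM] := ind_triv_mx_repr F G H.
have rSP : mx_repr G rS.
  split=> [|x y Gx Gy]; first by rewrite /rS -VG ?group1 // V1 mulmx1.
  rewrite /rS -!VG ?groupM // VM // !VG //.
  rewrite -[RHS]mulmxA (mulmxA rh) (mulmxA rh) rhio -Vs // !mulmxA.
  by rewrite -(mulmxA _ s) srh.
have hio : hom_mx G rS V io.
  by move=> x Gx; rewrite /rS -mulmxA rhio -mulmxA Vs // mulmxA ios.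
have hrh : hom_mx G V rS rh.
  by move=> x Gx; rewrite /rS !mulmxA rhio -Vs // -mulmxA srh.
exists m, (MxRepresentation rSP); split.
- split.
    rewrite em lt0n mxrank_eq0; apply: contraNneq ind_const_neq0 => s0.
    by rewrite -es s0 mulmx0.
  apply/(idem_primP (mulmx1 _) (hom_mx1 _)).
  exact: idem_prim_summand hio hrh io1 ios srh ps.
- exists (sigma *m rh) => [|x Gx].
    by apply: contraNneq ind_const_neq0 => e0; rewrite -es -rhio mulmxA e0 mul0mx.
  by rewrite -mulmxA -hrh // mulmxA perm_rep_const.
exists s, (1%:M - s); split.
- by apply/mxmoduleP=> x Gx; rewrite /= VG // -Vs // submxMl.
- apply/mxmoduleP=> x Gx; rewrite /= VG //.
  by rewrite mulmxBl mul1mx -Vs // -{1}(mulmx1 (V x)) -mulmxBr submxMl.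
- by rewrite submx1 -{1}(subrK s 1%:M) addrC addmx_sub_adds.
- rewrite sub0mx andbT; apply/rV_subP=> u; rewrite sub_capmx => /andP[].
  case/submxP=> a ->; case/submxP=> b e.
  by rewrite -ss mulmxA e -mulmxA mulmxBl mul1mx ss subrr mulmx0 sub0mx.
exists io; split; first by apply/row_freeP; exists rh.
  by apply/andP; split; [rewrite -{1}ios | rewrite -{1}rhio]; apply: submxMl.
by move=> x Gx; rewrite /= VG // hio.
Qed.
End Scott.

(** * Sums over coset representatives *)

Section Transversal.
Local Open Scope group_scope.
Variables (gT : finGroupType) (R Q : {group gT}).
Hypothesis sRQ : R \subset Q.
Let X := transversal (rcosets R Q) Q.

Lemma rcosets_transversal : is_transversal X (rcosets R Q) Q.
Proof. exact: transversalP (rcosets_partition sRQ). Qed.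

Lemma mem_rcosets_transversal x : x \in X -> x \in Q.
Proof. by move/(subsetP (transversal_sub rcosets_transversal)). Qed.

Lemma rcosets_transversal_inj x y : x \in X -> y \in X -> R :* x = R :* y -> x = y.
Proof.
have tI : trivIset (rcosets R Q) by case/and3P: (rcosets_partition sRQ).
have E z : z \in X -> pblock (rcosets R Q) z = R :* z.
  move/mem_rcosets_transversal=> Qz; apply: def_pblock tI _ (rcoset_refl _ _).
  by apply/rcosetsP; exists z.
move=> Xx Xy e; apply: (pblock_inj rcosets_transversal) => //.
by rewrite !E.
Qed.

Lemma rcosets_transversal_repr z : z \in Q -> exists2 x, x \in X & x \in R :* z.
Proof.
move=> Qz; have CP : R :* z \in rcosets R Q by apply/rcosetsP; exists z.
exists (transversal_repr 1 X (R :* z)).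
  exact: (repr_mem_transversal rcosets_transversal).
exact: (repr_mem_pblock rcosets_transversal).
Qed.

(** Sending [x] to the representative of [R :* (x * y)] permutes the transversal, and [h] depends
    only on the coset. *)
Lemma sum_transversal_translate (V : nmodType) (h : gT -> V) y : y \in Q ->
  (forall r z, r \in R -> z \in Q -> h (r * z) = h z) ->
  (\sum_(x in X) h (x * y)%g = \sum_(x in X) h x)%R.
Proof.
move=> Qy hh; pose phi x := odflt 1 [pick t in X :&: R :* (x * y)].
have phiP x : x \in X -> phi x \in X /\ phi x \in R :* (x * y).
  move/mem_rcosets_transversal=> Qx; rewrite /phi; case: pickP => [t /setIP[] // | no].
  have [t Xt Rt] := rcosets_transversal_repr (groupM Qx Qy).
  by have := no t; rewrite inE Xt Rt.
have phi_inj : {in X &, injective phi}.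
  move=> x x' Xx Xx' e; apply: rcosets_transversal_inj => //.
  have [_ /rcoset_eqP e1] := phiP x Xx; have [_ /rcoset_eqP e2] := phiP x' Xx'.
  by apply: (can_inj (rcosetK y)); rewrite -!rcosetM -e1 -e2 e.
have phiX : phi @: X = X.
  apply/eqP; rewrite eqEcard card_in_imset // leqnn andbT.
  by apply/subsetP=> _ /imsetP[x Xx ->]; have [] := phiP x Xx.
rewrite -[in RHS]phiX [RHS]big_imset //=; apply: eq_bigr => x Xx.
have [_ /rcosetP[r Rr ->]] := phiP x Xx; rewrite (hh r) //.
by rewrite groupM // mem_rcosets_transversal.
Qed.
End Transversal.

Lemma sum_orbit_transversal (gT : finGroupType) (G Q : {group gT}) (T : finType)
    (to : action G T) (k : T) (V : nmodType) (h : T -> V) : Q \subset G ->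
  (\sum_(i in orbit to Q k) h i =
   \sum_(x in transversal (rcosets 'C_Q[k | to] Q) Q) h (to k x))%R.
Proof.
move=> sQG; set X := transversal _ _.
have sRQ : 'C_Q[k | to]%g \subset Q by apply: subsetIl.
have fixk r : r \in 'C_Q[k | to]%g -> to k r = k.
  by case/setIP=> _ c; apply: astab_act c (set11 k).
have imX : orbit to Q k = to k @: X.
  apply/setP=> i; apply/idP/imsetP=> [/orbitP[z Qz <-] | [x Xx ->]].
    have [x Xx /rcosetP[r Rr e]] := rcosets_transversal_repr sRQ Qz.
    have /setIP[Qr _] := Rr.
    have Gr := subsetP sQG r Qr; have Gz := subsetP sQG z Qz.
    by exists x => //; rewrite e (actMin to k Gr Gz) (fixk r Rr).
  by apply: mem_orbit; apply: mem_rcosets_transversal Xx.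
rewrite imX big_imset //= => x y Xx Xy e.
apply: (rcosets_transversal_inj sRQ Xx Xy).
have Qx := mem_rcosets_transversal sRQ Xx; have Qy := mem_rcosets_transversal sRQ Xy.
apply/rcoset_eqP; rewrite mem_rcoset inE groupM ?groupV //=.
have Gx := subsetP sQG _ Qx; have Gy := subsetP sQG _ Qy.
rewrite !inE groupM ?groupV //= sub1set inE.
by rewrite (actMin to) ?groupV // e (actKin to) ?eqxx.
Qed.

(** * The Brauer quotient of a summand of a permutation module *)

Section BrauerSection.
Import GRing.Theory.
Local Open Scope ring_scope.
Variables (F : fieldType) (p : nat) (gT : finGroupType) (G Q : {group gT}).
Variables (n d : nat) (rM : mx_representation F G n) (to : action G 'I_d).
Variables (io : 'M[F]_(n, d)) (rh : 'M[F]_(d, n)).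
Hypothesis charF : p \in [pchar F].
Hypotheses (sQG : Q \subset G) (pQ : (p.-group Q)%g).
Let V := perm_rep F to.
Let D := fix_mx F to Q.
Hypotheses (hio : hom_mx G rM V io) (hrh : hom_mx G V rM rh).
Hypothesis io1 : io *m rh = 1%:M.

Lemma rel_trace_sub (R : {group gT}) : R \subset Q ->
  (rfix_mx rM R *m rel_trace rM R Q <= rfix_mx rM Q)%MS.
Proof.
move=> sRQ; apply/rfix_mxP=> y Qy.
have Gq z : z \in Q -> z \in G := subsetP sQG z.
rewrite /rel_trace mulmx_sumr mulmx_suml.
rewrite -[RHS](sum_transversal_translate sRQ Qy) => [|r z Rr Qz]; last first.
  by rewrite repr_mxM ?Gq // ?(subsetP sRQ) // mulmxA rfix_mx_id.
apply: eq_bigr => x /(mem_rcosets_transversal sRQ) Qx.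
by rewrite repr_mxM ?Gq // mulmxA.
Qed.

(** Every [x] in [Q] acts trivially after restriction to the fixed points, so the trace becomes
    [#|Q : R|] equal terms, which is 0 in characteristic [p]. *)
Lemma rel_trace_fix_mx (R : {group gT}) : R \proper Q ->
  rel_trace rM R Q *m (io *m D) = 0.
Proof.
move=> /andP[sRQ nRQ]; rewrite /rel_trace mulmx_suml.
rewrite (eq_bigr (fun=> io *m D)) => [|x /(mem_rcosets_transversal sRQ) Qx].
  rewrite sumr_const (card_transversal (rcosets_transversal sRQ)) -/(#|Q : R|%g).
  rewrite -scaler_nat; suff /eqP-> : (#|Q : R|%g%:R == 0 :> F) by rewrite scale0r.
  rewrite -(dvdn_pcharf charF); apply: contraR nRQ.
  rewrite -p'natE ?(pcharf_prime charF) // => p'i.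
  have pi : (p.-nat #|Q : R|)%g by apply: pnat_dvd (dvdn_indexg _ _) pQ.
  by rewrite -indexg_eq1 (pnat_1 pi p'i).
rewrite mulmxA hio ?(subsetP sQG) // -mulmxA.
by rewrite /V perm_rep_fix_mxr.
Qed.

(** A fixed [u] combines the rows of [rh] with coefficients constant on [Q]-orbits. If the
    coefficients at fixed points vanish, each remaining orbit sum is the trace of one row from the
    stabilizer of its point, a proper subgroup of [Q]. *)
Lemma brauer_kerP (u : 'rV[F]_n) : (u <= rfix_mx rM Q)%MS ->
  (u *m (io *m D) == 0) = (u <= brauer_ker rM Q)%MS.
Proof.
move=> /rfix_mxP uQ; apply/eqP/idP => [u0 | /sub_sumsmxP[a ->]]; last first.
  by rewrite mulmx_suml big1 // => R pR; rewrite -!mulmxA rel_trace_fix_mx ?mulmx0.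
pose w := u *m io.
have wQ x k : x \in Q -> w 0 (to k x) = w 0 k.
  move=> Qx; have Gx := subsetP sQG x Qx.
  have ew : w *m V x = w by rewrite /w -mulmxA -hio // mulmxA uQ.
  by rewrite -{1}ew mul_perm_repr.
have w0 k : k \in afix to Q -> w 0 k = 0.
  by move=> kQ; move/rowP/(_ k): u0; rewrite mulmxA mul_fix_mxr kQ => ->; rewrite mxE.
have -> : u = \sum_k w 0 k *: row k rh.
  by rewrite -[LHS]mulmx1 -io1 mulmxA mulmx_sum_row.
rewrite (partition_big (orbit to Q) predT) //= summx_sub // => O _.
have [k /eqP <- | no] := pickP [pred k | orbit to Q k == O]; last first.
  by rewrite big_pred0 // sub0mx.
rewrite (eq_bigl (mem (orbit to Q k))) => [|i /=]; last first.
  by apply/eqP/idP => H; apply/(orbit_in_eqP sQG).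
rewrite (eq_bigr (fun i => w 0 k *: row i rh)) => [|i /orbitP[x Qx <-]]; last first.
  by rewrite wQ.
rewrite -scaler_sumr; have [kQ | nkQ] := boolP (k \in afix to Q).
  by rewrite w0 // scale0r sub0mx.
rewrite scalemx_sub // sum_orbit_transversal //.
pose R := ('C_Q[k | to])%G.
have sRQ : R \subset Q by apply: subsetIl.
have fixk r : r \in R -> to k r = k.
  by case/setIP=> _ c; apply: astab_act c (set11 k).
have pR : R \proper Q.
  rewrite properE sRQ; apply: contra nkQ => sQR.
  by apply/afixP=> x Qx; rewrite fixk // (subsetP sQR).
have rowV x i : x \in G -> row (to i x) rh = row i rh *m rM x.
  move=> Gx; rewrite -row_mul -hrh //; apply/rowP=> j.
  by rewrite [RHS]mxE mul_perm_rep mxE.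
have sub_fix : (row k rh <= rfix_mx rM R)%MS.
  apply/rfix_mxP=> x Rx; have Gx := subsetP sQG x (subsetP sRQ x Rx).
  by rewrite -rowV // fixk.
rewrite (sumsmx_sup R) //; case/submxP: sub_fix => b eb.
apply/submxP; exists b; rewrite mulmxA -eb /rel_trace mulmx_sumr.
apply: eq_bigr => x /(mem_rcosets_transversal sRQ) Qx.
by rewrite rowV // (subsetP sQG).
Qed.

Lemma idem_prim_brauerP (K : {set gT}) : K \subset 'N_G(Q)%g ->
  (section_indec_or_zero rM K (rfix_mx rM Q) (brauer_ker rM Q) <->
   idem_prim K V (D *m (rh *m io) *m D)).
Proof.
move=> sKN; have sKG : K \subset G by apply: subset_trans sKN (subsetIl _ _).
have sQGg x : x \in Q -> x \in G := subsetP sQG x.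
have he : hom_mx G V V (rh *m io) by apply: hom_mxM hrh hio.
have heQ : hom_mx Q V V (rh *m io) by apply: hom_mxS he.
have hD : hom_mx K V V D by apply: hom_mxS sKN (hom_fix_mx _ _ sQG).
have hf : hom_mx K V V (D *m (rh *m io) *m D).
  by apply: (hom_mxM _ hD); apply: (hom_mxM hD); apply: hom_mxS he.
have ee : rh *m io *m (rh *m io) = rh *m io.
  by rewrite mulmxA -(mulmxA rh) io1 mulmx1.
have ff : D *m (rh *m io) *m D *m (D *m (rh *m io) *m D) = D *m (rh *m io) *m D.
  by rewrite -(brauer_mulmx charF sQG sQG sQG pQ heQ heQ) ee.
apply: iff_trans (idem_primP ff hf).
have rfixQ x : x \in Q -> rfix_mx rM Q *m rM x = rfix_mx rM Q by apply: rfix_mx_id.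
(* The comparison map embeds [M] into the permutation module and keeps the coordinates at [Q]-fixed
   points; its kernel on the fixed vectors is [brauer_ker]. *)
apply: (@section_transfer _ _ _ _ _ _ _ _ _ _ (io *m D)).
- move=> x Kx; have /setIP[Gx Nx] := subsetP sKN x Kx.
  apply/rfix_mxP=> y Qy; have Gy := sQGg y Qy.
  have Qyx : (y ^ x^-1)%g \in Q by rewrite memJ_norm ?groupV.
  rewrite -mulmxA -repr_mxM // conjgCV repr_mxM ?(groupV, groupJ) //.
  by rewrite mulmxA (rfixQ _ Qyx).
- by apply/sumsmx_subP=> R /andP[sRQ _]; apply: rel_trace_sub.
- apply/eqmxP/andP; split.
    have -> : rfix_mx rM Q *m (io *m D) = rfix_mx rM Q *m io *m (D *m (rh *m io) *m D).
      have e : rfix_mx rM Q *m (io *m D) = (rfix_mx rM Q *m io) *m ((rh *m io) *m D).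
        by rewrite -!mulmxA (mulmxA io rh) io1 mul1mx.
      rewrite e (mulmx_pgroup_fix (to := to) charF sQG pQ) ?mulmxA // => x Qx.
        by rewrite -mulmxA -hio ?sQGg // mulmxA rfixQ.
      by rewrite mulmxA he ?sQGg // -mulmxA /V perm_rep_fix_mxr.
    exact: submxMl.
  rewrite -mulmxA -mulmxA (mulmxA D) submxMr //.
  apply/rfix_mxP=> x Qx; rewrite -mulmxA -hrh ?sQGg // mulmxA.
  by rewrite /V fix_mx_perm_rep.
- exact: brauer_kerP.
move=> x Kx; rewrite -!mulmxA -hD // !mulmxA -(mulmxA _ _ io) hio ?(subsetP sKG) //.
by rewrite !mulmxA.
Qed.
End BrauerSection.

(** * Consequences of saturation *)

Section FusionLemmas.
Local Open Scope group_scope.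
Variables (gT : finGroupType) (p : nat) (G P : {group gT}).

Lemma exists_fully_normalized (Q : {group gT}) g : g \in G -> Q :^ g \subset P ->
  exists2 h, h \in G & fully_normalized G P (Q :^ h).
Proof.
move=> Gg sQP.
have := @arg_maxnP _ g (fun h => (h \in G) && (Q :^ h \subset P))
  (fun h => #|'N_P(Q :^ h)|).
rewrite Gg sQP => /(_ isT)[h /andP[Gh sQh] maxh].
exists h => //; split=> // x Gx; rewrite -conjsgM => sQx.
by apply: maxh; rewrite groupM ?sQx.
Qed.

(** Sylow's theorem in the automizer of [Q] aligns the action of [R] with that of [N_P(Q)]; the
    extension axiom, applied to a conjugation from [Q :^ g^-1] to [Q], then carries [R :^ g^-1] into
    [P]. *)
Lemma saturated_norm_conj (Q R : {group gT}) g :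
  saturated_FP p G P -> fully_normalized G P Q -> g \in G ->
  Q \subset R -> R \subset 'N_G(Q) -> p.-group R -> R \subset P :^ g ->
  exists2 n, n \in 'N_G(Q) & R :^ n \subset P.
Proof.
move=> [sat1 sat2] fnQ Gg sQR sRN pR sRP.
have [sRG nQR] : R \subset G /\ R \subset 'N(Q) by apply/subsetIP.
have [fcQ sylQ] := sat1 Q fnQ; have [sQP _] := fnQ.
(* [a] is induced by some [n] normalizing [Q], and [R :^ n] then acts on [Q] through automorphisms
   coming from [N_P(Q)]. *)
have [a] := Sylow_Jsub sylQ (morphimS (conj_aut Q) sRN) (morphim_pgroup _ pR).
case/morphimP=> n Nn /setIP[Gn _] ->; rewrite -morphimJ // => sRa.
pose g1 := g * n; have Gg1 : g1 \in G by rewrite groupM.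
pose Q' := (Q :^ g1^-1)%G.
have defQ : Q' :^ g1 = Q by rewrite /= conjsgKV.
have defQ' : Q' = Q :^ g^-1 :> {set gT}.
  by rewrite /= invMg conjsgM (normP (groupVr Nn)).
have sQ'P : Q' \subset P by rewrite defQ' sub_conjgV (subset_trans sQR).
have := sat2 Q' g1 sQ'P Gg1; rewrite defQ => /(_ sQP fcQ)[h Gh [sNh eh]].
have defQh : Q' :^ h = Q.
  rewrite -defQ; apply/setP=> x; apply/imsetP/imsetP=> [] [y Qy ->];
    by exists y; rewrite ?eh.
(* Since [h] agrees with [g1] on [Q'], this element normalizes [Q]; what remains is that [R :^ g^-1]
   lies in the domain [N_phi] of the extension. *)
exists (g^-1 * h).
  by rewrite inE groupM ?groupV //=; apply/normP; rewrite conjsgM -defQ' defQh.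
rewrite conjsgM (subset_trans _ sNh) // conjSg.
apply/subsetP=> y; rewrite mem_conjgV => Ry.
have Ny : y \in 'N(Q').
  by rewrite defQ' normJ mem_conjgV (subsetP nQR).
rewrite inE; apply/andP; split.
  by rewrite inE Ny andbT -(memJ_conjg _ g) (subsetP sRP).
have NQn : R :^ n \subset 'N(Q) by rewrite -(normP Nn) normJ conjSg.
have Ryn : y ^ g1 \in R :^ n by rewrite conjgM memJ_conjg.
have Nyn := subsetP NQn _ Ryn.
have /morphimP[u Nu NPu eu] := subsetP sRa _ (mem_morphim (conj_aut_morphism Q) Nyn Ryn).
rewrite defQ; apply/exists_inP; exists u => //.
apply/forall_inP=> z Qz; rewrite -mulgA -conjgE.
by rewrite -(norm_conj_autE Nyn Qz) -(norm_conj_autE Nu Qz) eu.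
Qed.
End FusionLemmas.

(** * Point stabilizers are the conjugates of [P] *)

Section Stabilizers.
Local Open Scope group_scope.
Variables (gT : finGroupType).

Lemma mem_stab1 (G : {group gT}) (T : finType) (to : action G T) i x :
  (x \in 'C_G[i | to]) = (x \in G) && (to i x == i).
Proof. by rewrite !inE sub1set inE; case: (x \in G). Qed.

Lemma stab1J (G : {group gT}) (T : finType) (to : action G T) i x : x \in G ->
  'C_G[to i x | to] = 'C_G[i | to] :^ x.
Proof. by move=> Gx; rewrite conjIg conjGid // astab1_act_in. Qed.

Lemma ind_stab (G P : {group gT}) g : P \subset G -> g \in G ->
  'C_G[ind_act G P (ind_base G P) g | ind_act G P] = P :^ g.
Proof.
move=> sPG Gg; apply/setP=> x; rewrite mem_stab1 mem_conjg.
have [Gx | nGx] := boolP (x \in G); last first.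
  by apply/esym; apply: contraNF nGx => /(subsetP sPG); rewrite groupJr ?groupV.
have Gx' : x ^ g^-1 \in G by rewrite groupJ ?groupV.
rewrite -(ind_act_base P Gx') conjgE invgK.
set to := ind_act G P; set b := ind_base G P.
rewrite (actMin to) ?groupM ?groupV // (actMin to) ?groupV //.
by rewrite -[in RHS](inj_eq (@act_inj _ _ _ to g)) (actKVin to Gg).
Qed.
End Stabilizers.

(** * Lifting endomorphisms from the Brauer quotient *)

Section Lift.
Import GRing.Theory.
Local Open Scope ring_scope.
Variables (F : fieldType) (p : nat) (gT : finGroupType) (G P Q : {group gT}).
Hypotheses (sPG : P \subset G) (pP : (p.-group P)%g) (sQG : Q \subset G).
Let to := ind_act G P.
Let V := perm_rep F to.
Let D := fix_mx F to Q.

(* An endomorphism of the Brauer quotient that vanishes at all larger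
   p-subgroups is supported on pairs of points with stabilizer exactly [Q];
   extending it along the [G]-orbits of such pairs lifts it to [G]. *)
Lemma brauer_lift (f : 'M[F]_(ind_dim G P)) :
  hom_mx 'N_G(Q)%g V V f -> D *m f *m D = f ->
  (forall R : {group gT}, Q \proper R -> R \subset 'N_G(Q)%g -> (p.-group R)%g ->
     fix_mx F to R *m f *m fix_mx F to R = 0) ->
  exists2 z, hom_mx G V V z & D *m z *m D = f.
Proof.
move=> hf DfD f0.
have finv x i l : x \in 'N_G(Q)%g -> f (to i x) (to l x) = f i l.
  by have [/(_ hf) + _] := hom_perm_repP to to f (subsetIl G 'N(Q)%g); apply.
pose stab i l := ('C_G[i | to] :&: 'C_G[l | to])%G.
have mem_stab i l x : (x \in stab i l) = [&& x \in G, to i x == i & to l x == l].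
  by rewrite inE !mem_stab1; case: (x \in G).
have stabJ i l x : x \in G -> stab (to i x) (to l x) = (stab i l :^ x)%g :> {set gT}.
  by move=> Gx; apply: etrans (esym (conjIg _ _ _)); congr (_ :&: _)%g;
    apply: stab1J.
(* A pair whose stabilizer is a conjugate of [Q] is moved to one with stabilizer [Q] and given the
   value of [f] there; every other pair gets 0. *)
pose z : 'M[F]_(ind_dim G P) := \matrix_(i, l)
  if [pick g | (g \in G) && (stab i l == Q :^ g :> {set gT})%g] is Some g
  then f (to i g^-1%g) (to l g^-1%g) else 0.
(* The value does not depend on the conjugator: two choices differ by an element of [N_G(Q)], under
   which [f] is invariant. *)
have zE i l g : g \in G -> stab i l = (Q :^ g)%g :> {set gT} ->
    z i l = f (to i g^-1%g) (to l g^-1%g).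
  move=> Gg e; rewrite mxE; case: pickP => [h /andP[Gh /eqP eh] | /(_ g)]; last first.
    by rewrite Gg e eqxx.
  have Nn : (h * g^-1)%g \in 'N_G(Q)%g.
    rewrite inE groupM ?groupV //=; apply/normP.
    by rewrite conjsgM -eh e conjsgK.
  rewrite -[LHS](finv _ _ _ Nn) -!(actMin to) ?groupM ?groupV //.
  by rewrite !mulKg.
exists z.
  apply/hom_perm_repP=> // x i l Gx.
  have [g /andP[Gg /eqP e] | no] :=
      pickP [pred g | (g \in G) && (stab i l == Q :^ g :> {set gT})%g].
    rewrite (zE _ _ _ Gg e) (zE _ _ (g * x)%g) ?groupM //; last first.
      by rewrite stabJ // e conjsgM.
    by rewrite invMg !(actMin to) ?groupV // !(actKin to).
  rewrite !mxE; case: pickP => [g /andP[Gg]|_]; last first.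
    by case: pickP => // g hg; have := no g; rewrite [_ g]hg.
  rewrite stabJ // => /eqP e; have := no (g * x^-1)%g.
  by rewrite /= groupM ?groupV //= conjsgM -e conjsgK eqxx.
apply/matrixP=> i l; rewrite -[in RHS]DfD !mul_fix_mxr !mul_fix_mx.
case: ifP => // lQ; case: ifP => // iQ.
have sQs : Q \subset stab i l.
  apply/subsetP=> x Qx; rewrite mem_stab (subsetP sQG) //.
  by rewrite (afixP iQ) ?(afixP lQ) ?eqxx.
have [eQ | neQ] := eqVneq (gval Q) (stab i l).
  by rewrite (zE _ _ 1%g) ?group1 // ?conjsg1 ?invg1 ?act1.
have pQs : Q \proper stab i l by rewrite properEneq neQ.
have -> : z i l = 0.
  rewrite mxE; case: pickP => // g /andP[_ /eqP e].
  by have := proper_card pQs; rewrite e cardJg ltnn.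
(* The stabilizer lies in a conjugate of [P], so [Q] grows properly inside it on taking normalizers;
   the vanishing hypothesis at that normalizer gives [f i l = 0]. *)
have ps : (p.-group (stab i l))%g.
  have [g Gg ei] := ind_act_trans i.
  have eC : ('C_G[i | to] = P :^ g)%g by rewrite ei; apply: ind_stab.
  apply: (@pgroupS _ _ (P :^ g)%G); last by rewrite pgroupJ.
  by apply/subsetP=> x /setIP[+ _]; rewrite /= eC.
have Rprop := nilpotent_proper_norm (pgroup_nil ps) pQs.
set R := ('N_(stab i l)(Q))%G in Rprop.
have sRs : R \subset stab i l by apply: subsetIl.
have sRN : R \subset 'N_G(Q)%g.
  by apply: setSI; apply/subsetP=> x; rewrite mem_stab => /andP[].
have := f0 R Rprop sRN (pgroupS sRs ps).
move/matrixP/(_ i l); rewrite mul_fix_mxr mul_fix_mx mxE !ifT //.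
  by apply/afixP=> x /(subsetP sRs); rewrite mem_stab => /and3P[_ /eqP].
by apply/afixP=> x /(subsetP sRs); rewrite mem_stab => /and3P[_ _ /eqP].
Qed.
End Lift.

(** * Nonvanishing of Scott idempotents on fixed points *)

Section ScottFix.
Import GRing.Theory.
Local Open Scope ring_scope.
Variables (F : fieldType) (p : nat) (gT : finGroupType) (G H : {group gT}).
Hypothesis charF : p \in [pchar F].
Let d := ind_dim G H.
Let to := ind_act G H.
Let b := ind_base G H.

Lemma ind_base_fix (R : {group gT}) : R \subset G -> R \subset H -> b \in afix to R.
Proof.
move=> /subsetP sRG /subsetP sRH; apply/afixP=> x Rx; apply/eqP.
by rewrite ind_act_base ?sRG ?sRH.
Qed.

Lemma scott_col_sum (s : 'M[F]_d) :
  const_mx 1 *m s = const_mx 1 :> 'rV[F]_d -> \sum_i s i b = 1.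
Proof.
move/rowP/(_ b); rewrite !mxE => <-.
by apply: eq_bigr => i _; rewrite mxE mul1r.
Qed.

(** The column of the base point sums to 1 and is [R]-invariant, so its entries at [R]-fixed points
    already sum to 1. *)
Lemma scott_fix_neq0 (s : 'M[F]_d) (R : {group gT}) :
  R \subset G -> R \subset H -> (p.-group R)%g ->
  hom_mx R (perm_rep F to) (perm_rep F to) s ->
  const_mx 1 *m s = const_mx 1 :> 'rV[F]_d ->
  fix_mx F to R *m s *m fix_mx F to R != 0.
Proof.
move=> sRG sRH pR hs es; apply/eqP=> e0.
have bR := ind_base_fix sRG sRH.
have := scott_col_sum es; rewrite (sum_pgroup_fix (to := to) charF sRG pR) => [|x i Rx]; last first.
  by rewrite -[in LHS]((afixP bR) x Rx); have [/(_ hs) + _] := hom_perm_repP to to s sRG; apply.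
rewrite big1 => [/eqP|i iR]; first by rewrite eq_sym oner_eq0.
by move/matrixP/(_ i b): e0; rewrite mul_fix_mxr bR mul_fix_mx iR mxE.
Qed.
End ScottFix.

(** * Embedding the cosets of [T] in [N] as an orbit *)

Section OrbitMap.
Import GRing.Theory.
Local Open Scope ring_scope.
Variables (F : fieldType) (gT : finGroupType) (G N T : {group gT}) (d : nat).
Variables (to : action G 'I_d) (j : 'I_d).
Hypotheses (sNG : N \subset G) (sTN : T \subset N).
Hypothesis stabj : forall x, x \in N -> (to j x == j) = (x \in T).
Let to0 := ind_act N T.
Let b := ind_base N T.

(** The usual bijection from cosets of the stabilizer to the orbit of [j]; since [T] is the
    stabilizer of [j] in [N], the chosen representative is immaterial. *)
Definition orbit_map (i : 'I_(ind_dim N T)) : 'I_d := to j (repr (ind_pt i)).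

Lemma orbit_mapE g : g \in N -> orbit_map (to0 b g) = to j g.
Proof.
move=> Ng; rewrite /orbit_map /to0 /= ind_toE Ng ind_baseE.
have /rcosetP[t Tt ->] := mem_repr_rcoset T g.
have Nt := subsetP sTN t Tt.
rewrite (actMin to) ?(subsetP sNG) //; congr (to _ g).
by apply/eqP; rewrite stabj.
Qed.

Lemma orbit_map_act i x : x \in N -> orbit_map (to0 i x) = to (orbit_map i) x.
Proof.
move=> Nx; have [g Ng ->] := ind_act_trans i.
rewrite -(actMin to0) // !orbit_mapE ?groupM //.
by rewrite (actMin to) ?(subsetP sNG).
Qed.

Lemma orbit_map_base : orbit_map b = j.
Proof. by rewrite -(act1 to0 b) orbit_mapE ?group1 // act1. Qed.

Lemma orbit_map_inj : injective orbit_map.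
Proof.
move=> i l; have [g Ng ->] := ind_act_trans i; have [h Nh ->] := ind_act_trans l.
rewrite !orbit_mapE // => e.
have Gg := subsetP sNG g Ng; have Gh := subsetP sNG h Nh.
have Ngh : (g * h^-1)%g \in N by rewrite groupM ?groupV.
have : to j (g * h^-1)%g == j by rewrite (actMin to) ?groupV // e (actKin to).
rewrite (stabj Ngh) => Tgh.
have : to0 b (g * h^-1)%g = b by apply/eqP; rewrite ind_act_base.
by rewrite (actMin to0) ?groupV // => /(congr1 (to0^~ h)); rewrite (actKVin to0).
Qed.

Lemma orbit_map_im : orbit_map @: setT = orbit to N j.
Proof.
apply/setP=> l; apply/imsetP/orbitP=> [[i _ ->] | [x Nx <-]].
  by have [g Ng ->] := ind_act_trans i; exists g; rewrite ?orbit_mapE.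
by exists (to0 b x); rewrite ?orbit_mapE ?inE.
Qed.

Definition orbit_mx : 'M[F]_(ind_dim N T, d) := \matrix_(i, l) (l == orbit_map i)%:R.

Lemma mul_orbit_mx m (X : 'M[F]_(d, m)) i l : (orbit_mx *m X) i l = X (orbit_map i) l.
Proof.
rewrite mxE (bigD1 (orbit_map i)) //= big1 ?addr0 => [|k nk]; rewrite mxE ?eqxx ?mul1r //.
by rewrite (negPf nk) mul0r.
Qed.

Lemma mul_orbit_mxr m (X : 'M[F]_(m, d)) i l :
  (X *m orbit_mx^T) i l = X i (orbit_map l).
Proof.
rewrite mxE (bigD1 (orbit_map l)) //= big1 ?addr0 => [|k nk]; rewrite !mxE ?eqxx ?mulr1 //.
by rewrite (negPf nk) mulr0.
Qed.

Lemma orbit_mx_hom x i l : x \in N -> orbit_mx (to0 i x) (to l x) = orbit_mx i l.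
Proof. by move=> Nx; rewrite !mxE orbit_map_act // (inj_eq (act_inj to x)). Qed.

Lemma hom_orbit_mx : hom_mx N (perm_rep F to0) (perm_rep F to) orbit_mx.
Proof. by apply/hom_perm_repP=> // x i l; apply: orbit_mx_hom. Qed.

Lemma hom_orbit_mxT : hom_mx N (perm_rep F to) (perm_rep F to0) orbit_mx^T.
Proof.
apply/hom_perm_repP=> // x i l Nx.
by rewrite [LHS]mxE [RHS]mxE orbit_mx_hom.
Qed.
End OrbitMap.

(** * The local Scott module as a summand of the Brauer quotient *)

Section ScottSummand.
Import GRing.Theory.
Local Open Scope ring_scope.
Variables (F : fieldType) (p : nat) (gT : finGroupType) (G P Q : {group gT}).
Hypothesis charF : p \in [pchar F].
Hypotheses (sPG : P \subset G) (pP : (p.-group P)%g).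
Hypothesis fnQ : fully_normalized G P Q.
Let N := ('N_G(Q))%G.
Let T := ('N_P(Q))%G.
Let to := ind_act G P.
Let V := perm_rep F to.
Let D := fix_mx F to Q.
Let b := ind_base G P.

Let sQP : Q \subset P. Proof. by case: fnQ. Qed.
Let sQG : Q \subset G. Proof. exact: subset_trans sQP sPG. Qed.
Let sQT : Q \subset T. Proof. by rewrite subsetI sQP normG. Qed.
Let sTN : T \subset N. Proof. exact: setSI. Qed.
Let sTP : T \subset P. Proof. exact: subsetIl. Qed.
Let sTG : T \subset G. Proof. exact: subset_trans sTP sPG. Qed.
Let pT : (p.-group T)%g. Proof. exact: pgroupS sTP pP. Qed.
Let sNG : N \subset G. Proof. exact: subsetIl. Qed.

(* [T] is contained in the stabilizer, whose order is at most [|T|] because [Q]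
   is fully normalized. *)
Lemma stab_fix_normalizer j : j \in afix to T ->
  forall x, x \in N -> (to j x == j) = (x \in T).
Proof.
have [g Gg ->] := ind_act_trans j => /afixP fj.
have eC : ('C_G[to b g | to] = P :^ g)%g by apply: ind_stab.
have sTS : T \subset 'N_(P :^ g)(Q)%g.
  apply/subsetP=> x Tx; have Gx := subsetP sTG x Tx.
  have /setIP[_ Nx] := Tx.
  by rewrite inE Nx andbT -eC mem_stab1 Gx fj ?eqxx.
have sQg : (Q :^ g^-1)%g \subset P.
  by rewrite sub_conjgV (subset_trans sQT) // (subset_trans sTS) // subsetIl.
have leq : (#|'N_(P :^ g)(Q)%g| <= #|T|)%N.
  have [_ /(_ g^-1%g)] := fnQ; rewrite groupV => /(_ Gg sQg).
  by rewrite -(cardJg _ g) conjIg -normJ conjsgKV.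
have eT : gval T = 'N_(P :^ g)(Q)%g by apply/eqP; rewrite eqEcard sTS leq.
move=> x Nx; have Gx := subsetP sNG x Nx; have /setIP[_ nx] := Nx.
by rewrite eT inE nx andbT -eC mem_stab1 Gx.
Qed.

(** The base column of [e] sums to 1 and is [T]-invariant. An [N]-orbit without [T]-fixed points
    contributes 0, so some orbit of a [T]-fixed point has nonzero sum. *)
Lemma exists_fix_orbit_sum (e : 'M[F]_(ind_dim G P)) :
  hom_mx G V V e -> const_mx 1 *m e = const_mx 1 :> 'rV[F]_(ind_dim G P) ->
  exists2 j, j \in afix to T & \sum_(i in orbit to N j) e i b != 0.
Proof.
move=> he es.
have [/exists_inP[j jT jX]|no] :=
    boolP [exists j in afix to T, \sum_(i in orbit to N j) e i b != 0].
  by exists j.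
have bT : b \in afix to T by apply: ind_base_fix.
have einv x i : x \in T -> e (to i x) b = e i b.
  move=> Tx; rewrite -[in LHS]((afixP bT) x Tx).
  have [/(_ he) + _] := hom_perm_repP to to e (subxx G); apply.
  exact: (subsetP sTG).
have := scott_col_sum es; rewrite (partition_big (orbit to N) predT) //= big1.
  by move/eqP; rewrite eq_sym oner_eq0.
move=> O _; have [/exists_inP[j jT /eqP <-]|noT] :=
    boolP [exists j in afix to T, orbit to N j == O].
  rewrite (eq_bigl (mem (orbit to N j))) => [|i].
    by apply: contraNeq no => nz; apply/exists_inP; exists j.
  by apply/eqP/idP=> /(orbit_in_eqP sNG).
rewrite big_mkcond (sum_pgroup_fix (to := to) charF sTG pT) => [|x k Tx]; last first.
  by rewrite (orbit_act_in to) ?(subsetP sTN) // einv.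
apply: big1 => i iT; case: eqP => // eO.
by case/exists_inP: noT; exists i => //; apply/eqP.
Qed.

(** Both [j] and the base point have stabilizer [T] in [N], so their orbits are copies of the cosets
    of [T]. Passing from one copy to the other through [f] scales the fixed vector by the nonzero
    orbit sum, and Fitting's lemma makes the composite on [S] invertible. *)
Lemma scott_summand (e : 'M[F]_(ind_dim G P)) m (rS : mx_representation F N m) :
  hom_mx G V V e -> e *m e = e ->
  const_mx 1 *m e = const_mx 1 :> 'rV[F]_(ind_dim G P) ->
  is_scott T rS ->
  exists (al : 'M[F]_(m, ind_dim G P)) (be : 'M[F]_(ind_dim G P, m)),
    [/\ hom_mx N rS V al, hom_mx N V rS be, al *m be = 1%:M,
        al *m (D *m e *m D) = al & (D *m e *m D) *m be = be].
Proof.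
move=> he ee es scS; have [indS _ _] := scS.
have [ioS [rhS [hioS hrhS ioS1 sS]]] := scott_split scS.
set f := D *m e *m D.
have heQ : hom_mx Q V V e by apply: hom_mxS sQG he.
have pQ : (p.-group Q)%g by apply: pgroupS sQP pP.
have ff : f *m f = f.
  by rewrite /f -(brauer_mulmx charF sQG sQG sQG pQ heQ heQ) ee.
have hD : hom_mx N V V D by apply: hom_fix_mx.
have hf : hom_mx N V V f.
  by apply: (hom_mxM _ hD); apply: (hom_mxM hD); apply: hom_mxS sNG he.
have [j jT Xj] := exists_fix_orbit_sum he es.
have bT : b \in afix to T by apply: ind_base_fix.
have fE l : l \in afix to Q -> f l b = e l b.
  by move=> lQ; rewrite /f mul_fix_mxr mul_fix_mx lQ (subsetP (afixS to sQT)).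
clearbody f.
have stj := stab_fix_normalizer jT; have stb := stab_fix_normalizer bT.
pose Th i := @orbit_mx F gT G N T _ to i.
have hTj : hom_mx N (perm_rep F (ind_act N T)) V (Th j) by apply: hom_orbit_mx.
have hTb : hom_mx N V (perm_rep F (ind_act N T)) (Th b)^T by apply: hom_orbit_mxT.
pose c := Th j *m f *m (Th b)^T.
have hc : hom_mx N (perm_rep F (ind_act N T)) (perm_rep F (ind_act N T)) c.
  by apply: hom_mxM hTb; apply: hom_mxM hTj hf.
pose s0 : 'rV[F]_(ind_dim N T) := const_mx 1.
(* A fixed vector is a multiple of [s0], so only the base coordinate is needed; the orbit of [j]
   consists of [Q]-fixed points, where [f] and [e] have the same base column. *)
have sc : s0 *m c = (\sum_(i in orbit to N j) e i b) *: s0.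
  have hw x : x \in N -> s0 *m c *m perm_rep F (ind_act N T) x = s0 *m c.
    by move=> Nx; rewrite -mulmxA -hc // mulmxA perm_rep_const.
  rewrite (ind_fixed_const hw); congr (_ *: _).
  rewrite mxE -(orbit_map_im sNG sTN stj) big_imset /=; last first.
    by move=> ? ? _ _; apply: (orbit_map_inj sNG sTN stj).
  rewrite [RHS](eq_bigl predT) => [|i]; last by rewrite inE.
  apply: eq_bigr => i _.
  rewrite [s0 _ _]mxE mul1r /c mul_orbit_mxr mul_orbit_mx.
  rewrite (orbit_map_base sNG sTN stb) fE //.
  have [g Ng ->] := ind_act_trans i; rewrite (orbit_mapE sNG sTN stj) //.
  have /setIP[Gg nQg] := Ng.
  have <- : (Q :^ g)%g = Q by apply/normP.
  by rewrite mem_afixJ // (subsetP (afixS to sQT)).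
pose al := ioS *m Th j *m f; pose be := f *m (Th b)^T *m rhS.
have hal : hom_mx N rS V al by apply: hom_mxM hf; apply: hom_mxM hioS hTj.
have hbe : hom_mx N V rS be by apply: hom_mxM hrhS; apply: hom_mxM hf hTb.
have aby : al *m be = ioS *m c *m rhS.
  by rewrite /al /be /c !mulmxA -(mulmxA _ f f) ff.
clearbody c.
have hy : hom_mx N rS rS (al *m be) by apply: hom_mxM hal hbe.
have uy : al *m be \in unitmx.
  (* The fixed vector [w] of [S] is an eigenvector for the orbit sum, so nilpotence would make that
     sum 0. *)
  case: (indec_fitting indS hy) => // [[k yk0]]; case/eqP: Xj.
  set X := \sum_(i in _) _ in sc *.
  pose w := s0 *m rhS.
  have wy : w *m (al *m be) = X *: w.
    by rewrite aby /w !mulmxA -(mulmxA s0 rhS) sS sc -scalemxAl.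
  have wyk l : w *m (al *m be) ^+ l = X ^+ l *: w.
    elim: l => [|l IH]; first by rewrite mulmx1 scale1r.
    by rewrite exprSr mulmxA IH -scalemxAl wy scalerA exprSr.
  have w0 : w != 0.
    apply: contraNneq (ind_const_neq0 F N T) => w0.
    by rewrite -sS mulmxA -/s0 -/w w0 mul0mx.
  have := wyk k; rewrite yk0 mulmx0 => /esym/eqP.
  by rewrite scaler_eq0 (negPf w0) orbF expf_eq0 => /andP[_ /eqP].
exists al, (be *m invmx (al *m be)); split=> //.
- by apply: hom_mxM hbe _; apply: hom_mxV.
- by rewrite mulmxA mulmxV.
- by rewrite /al -mulmxA ff.
by rewrite /be !mulmxA ff.
Qed.
End ScottSummand.

(** * Conjugating idempotents by group elements *)

Section PermRepMorphism.
Import GRing.Theory.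
Local Open Scope ring_scope.
Variables (F : fieldType) (gT : finGroupType) (G : {group gT}).
Variables (d : nat) (to : action G 'I_d).
Let V := perm_rep F to.

Lemma perm_repM x y : x \in G -> y \in G -> V (x * y)%g = V x *m V y.
Proof.
move=> Gx Gy; apply/matrixP=> i j.
by rewrite mul_perm_rep !mxE (actMin to).
Qed.

Lemma perm_rep1 : V 1%g = 1%:M.
Proof. by apply/matrixP=> i j; rewrite !mxE act1 eq_sym. Qed.

Lemma perm_repK x : x \in G -> V x *m V x^-1%g = 1%:M.
Proof. by move=> Gx; rewrite -perm_repM ?groupV // mulgV perm_rep1. Qed.

Lemma perm_repVK x : x \in G -> V x^-1%g *m V x = 1%:M.
Proof. by move=> Gx; rewrite -perm_repM ?groupV // mulVg perm_rep1. Qed.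

Lemma hom_mx_mul (A B : {set gT}) X : A \subset G -> B \subset G ->
  hom_mx A V V X -> hom_mx B V V X -> hom_mx (A * B)%g V V X.
Proof.
move=> /subsetP sA /subsetP sB hA hB _ /mulsgP[x y Ax By ->].
have Gx := sA x Ax; have Gy := sB y By.
by rewrite (perm_repM Gx Gy) -mulmxA hB // mulmxA hA // mulmxA.
Qed.

Lemma idem_prim_conj (K : {set gT}) f x : K \subset G -> x \in G ->
  f *m f = f ->
  hom_mx K V V f -> idem_prim (K :^ x)%g V (V x^-1%g *m f *m V x) -> idem_prim K V f.
Proof.
move=> /subsetP sKG Gx ff hf H c cc cf fc hc.
have VK m (X : 'M_(d, m)) : V x *m (V x^-1%g *m X) = X.
  by rewrite mulmxA perm_repK // mul1mx.
have KV m (X : 'M_(m, d)) : X *m V x *m V x^-1%g = X.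
  by rewrite -mulmxA perm_repK // mulmx1.
pose J X := V x^-1%g *m X *m V x.
have JM X Y : J X *m J Y = J (X *m Y).
  by rewrite /J -!mulmxA VK.
have JI X : V x *m J X *m V x^-1%g = X by rewrite /J !mulmxA KV perm_repK // mul1mx.
case: (H (J c)); rewrite -/(J f) ?JM ?cc ?cf ?fc //.
- move=> _ /imsetP[y Ky ->]; have Gy := sKG y Ky.
  rewrite conjgE !perm_repM ?groupV ?groupM //.
  rewrite /J -!mulmxA !VK; congr (_ *m _).
  by rewrite mulmxA hc // !mulmxA.
- by move=> e; left; rewrite -(JI c) e mulmx0 mul0mx.
by move=> e; right; rewrite -(JI c) e JI.
Qed.
End PermRepMorphism.

(** * The induction proving that (2) implies (1) *)

Section ScottBrauer.
Import GRing.Theory.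
Local Open Scope ring_scope.
Variables (F : fieldType) (p : nat) (gT : finGroupType) (G P : {group gT}).
Hypothesis charF : p \in [pchar F].
Hypotheses (sPG : P \subset G) (pP : (p.-group P)%g).
Hypothesis satP : saturated_FP p G P.
Variables (n : nat) (rM : mx_representation F G n).
Hypothesis indM : mx_indecomposable rM G.
Let d := ind_dim G P.
Let to := ind_act G P.
Let V := perm_rep F to.
Local Notation D Q := (fix_mx F to Q).
Variables (io : 'M[F]_(n, d)) (rh : 'M[F]_(d, n)).
Hypotheses (hio : hom_mx G rM V io) (hrh : hom_mx G V rM rh).
Hypothesis io1 : io *m rh = 1%:M.
Let e := rh *m io.
Hypothesis es : const_mx 1 *m e = const_mx 1 :> 'rV[F]_d.

Let he : hom_mx G V V e. Proof. exact: hom_mxM hrh hio. Qed.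
Let ee : e *m e = e.
Proof. by rewrite /e mulmxA -(mulmxA rh) io1 mulmx1. Qed.

Lemma QC_sub_norm (Q : {group gT}) : Q \subset G -> (Q * 'C_G(Q) \subset 'N_G(Q))%g.
Proof.
move=> sQG; rewrite mul_subG //; first by rewrite subsetI sQG normG.
by rewrite setIS ?cent_sub.
Qed.

Section FullyNormalized.
Variable Q : {group gT}.
Hypothesis fnQ : fully_normalized G P Q.
Hypothesis IH : forall R : {group gT}, (#|Q| < #|R|)%N -> R \subset G ->
  (p.-group R)%g -> idem_prim (R * 'C_G(R))%g V (D R *m e *m D R).
Variables (m : nat) (rS : mx_representation F ('N_G(Q))%G m).
Hypothesis scS : is_scott ('N_P(Q))%G rS.
Hypothesis indS : mx_indecomposable rS (Q * 'C_G(Q))%g.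
Let N := ('N_G(Q))%G.
Let f := D Q *m e *m D Q.

Lemma idem_prim_fully_normalized : idem_prim (Q * 'C_G(Q))%g V f.
Proof.
have [sQP _] := fnQ; have sQG : Q \subset G := subset_trans sQP sPG.
have pQ : (p.-group Q)%g := pgroupS sQP pP.
have [al [be [hal hbe ab af fb]]] := scott_summand charF sPG pP fnQ he ee es scS.
rewrite -/e -/f in af fb.
have sKN := QC_sub_norm sQG.
pose f1 := be *m al; pose f2 := f - f1.
have f11 : f1 *m f1 = f1 by rewrite /f1 mulmxA -(mulmxA be) ab mulmx1.
have f1f : f1 *m f = f1 by rewrite /f1 -mulmxA af.
have ff1 : f *m f1 = f1 by rewrite /f1 mulmxA fb.
have hf1 : hom_mx N V V f1 by apply: hom_mxM hbe hal.
have sNG : N \subset G by apply: subsetIl.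
have hD : hom_mx N V V (D Q) by apply: hom_fix_mx.
have hf : hom_mx N V V f.
  by apply: (hom_mxM _ hD); apply: (hom_mxM hD); apply: hom_mxS sNG he.
have heQ : hom_mx Q V V e by apply: hom_mxS sQG he.
have brM X Y : hom_mx Q V V X -> hom_mx Q V V Y ->
    D Q *m (X *m Y) *m D Q = (D Q *m X *m D Q) *m (D Q *m Y *m D Q).
  by apply: (brauer_mulmx charF).
have ff : f *m f = f by rewrite /f -brM // ee.
have DfD : D Q *m f *m D Q = f.
  by rewrite /f !mulmxA fix_mx_idem -mulmxA fix_mx_idem.
have Df : D Q *m f = f by rewrite /f !mulmxA fix_mx_idem.
have fD : f *m D Q = f by rewrite /f -!mulmxA fix_mx_idem.
have f12 : f1 *m f2 = 0 by rewrite mulmxBr f1f f11 subrr.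
have ff2 : f *m f2 = f2 by rewrite mulmxBr ff ff1.
have f2f : f2 *m f = f2 by rewrite mulmxBl ff f1f.
have f22 : f2 *m f2 = f2 by rewrite {1}/f2 mulmxBl ff2 f12 subr0.
have hf2 : hom_mx N V V f2 by apply: hom_mxB.
have f1n0 : f1 != 0.
  apply/eqP=> f10; have [m0 _] := indS.
  have : al *m f1 *m be = 1%:M by rewrite /f1 !mulmxA ab mul1mx ab.
  rewrite f10 mulmx0 mul0mx => /(congr1 mxrank); rewrite mxrank0 mxrank1 => m0'.
  by rewrite -m0' in m0.
(* If [f2] vanishes, [f] cuts out [S] itself, which is indecomposable over [Q * 'C_G(Q)] by
   assumption. *)
have [f20 | f2n0] := eqVneq f2 0.
  have ef : be *m al = f by apply/eqP; rewrite eq_sym -subr_eq0 -/f1 -/f2 f20.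
  have [_ /(idem_primP (mulmx1 _) (hom_mx1 _)) pS] := indS.
  apply: idem_prim_summand (hom_mxS sKN hbe) (hom_mxS sKN hal) ef _ _ pS.
    exact: mulmx1.
  exact: mul1mx.
case: (boolP [exists R : {group gT}, [&& Q \proper R, R \subset N, (p.-group R)%g
    & D R *m f2 *m D R != 0]]) => [/existsP[R /and4P[pQR sRN pR nz]] | no].
  (* A nonzero restriction provides an [R]-fixed point, so [R] lies in a conjugate of [P] and can be
     moved into [N_P(Q)]. *)
  have [i iR | noi] := pickP (mem (afix to R)); last first.
    case/eqP: nz; apply/matrixP=> i j; rewrite mul_fix_mxr mul_fix_mx.
    have -> : (i \in afix to R) = false := noi i.
    by rewrite if_same mxE.
  have [g Gg ei] := ind_act_trans i.
  have sRG : R \subset G := subset_trans sRN sNG.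
  have sRP : R \subset (P :^ g)%g.
    rewrite -(ind_stab sPG Gg) -ei; apply/subsetP=> x Rx; rewrite mem_stab1 (subsetP sRG) //.
    by move/afixP: iR => ->; rewrite ?eqxx.
  have [x Nx sRxP] := saturated_norm_conj satP fnQ Gg (proper_sub pQR) sRN pR sRP.
  have /setIP[Gx nQx] := Nx.
  pose R1 := (R :^ x)%G.
  have sQR1 : Q \subset R1 by rewrite -(normP nQx) conjSg proper_sub.
  have sR1N : R1 \subset N by rewrite -(conjGid Nx) conjSg.
  have sR1G : R1 \subset G := subset_trans sR1N sNG.
  have sR1T : R1 \subset ('N_P(Q))%G.
    rewrite subsetI sRxP; apply: subset_trans sR1N _; exact: subsetIr.
  have pR1 : (p.-group R1)%g by rewrite pgroupJ.
  have nz1 : D R1 *m f2 *m D R1 != 0.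
    apply: contraNneq nz => e0.
    have : V x *m (D R1 *m f2 *m D R1) = D R *m f2 *m D R *m V x.
      by rewrite !mulmxA perm_rep_fix_mx // -(mulmxA (D R)) hf2 // !mulmxA
                 -(mulmxA _ (V x)) perm_rep_fix_mx // mulmxA.
    rewrite e0 mulmx0 => /(congr1 (mulmx^~ (V x^-1%g))).
    by rewrite -(mulmxA _ (V x)) perm_repK // mulmx1 mul0mx => <-.
  have br1M X Y : hom_mx N V V X -> hom_mx N V V Y ->
      D R1 *m (X *m Y) *m D R1 = (D R1 *m X *m D R1) *m (D R1 *m Y *m D R1).
    move=> hX hY; apply: (brauer_mulmx charF) => //; first exact: hom_mxS hX.
    exact: hom_mxS hY.
  have e1 : D R1 *m e *m D R1 = D R1 *m f *m D R1.
    by rewrite /f !mulmxA fix_mxSr // -!mulmxA fix_mxS.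
  (* The Scott idempotent of [S] factors through [f1] and does not vanish on [R1]-fixed points, so
     neither does [f1]. *)
  have nz2 : D R1 *m f1 *m D R1 != 0.
    have [ioS [rhS [hioS hrhS ioS1 sS]]] := scott_split scS.
    have hsS : hom_mx N _ _ (rhS *m ioS) := hom_mxM hrhS hioS.
    have := scott_fix_neq0 charF sR1N sR1T pR1 (hom_mxS sR1N hsS) sS.
    apply: contraNneq => e0.
    have -> : rhS *m ioS = rhS *m al *m (f1 *m (be *m ioS)).
      rewrite /f1 !mulmxA -(mulmxA rhS al be) ab mulmx1.
      by rewrite -(mulmxA rhS al be) ab mulmx1.
    have h1 := hom_mxS sR1N (hom_mxM hrhS hal).
    have h3 := hom_mxS sR1N (hom_mxM hbe hioS).
    have h2 := hom_mxS sR1N hf1.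
    rewrite (brauer_mulmx charF sR1N sR1G sR1N pR1 h1 (hom_mxM h2 h3)).
    by rewrite (brauer_mulmx charF sR1G sR1G sR1N pR1 h2 h3) e0 mul0mx mulmx0.
  have ltR1 : (#|Q| < #|R1|)%N by rewrite cardJg proper_card.
  have sCN : (R1 * 'C_G(R1) \subset N)%g.
    rewrite mul_subG //; apply: setIS; apply: subset_trans (cent_sub _).
    exact: centS.
  have hD1 : hom_mx (R1 * 'C_G(R1))%g V V (D R1).
    by apply: hom_mxS (QC_sub_norm sR1G) (hom_fix_mx _ _ sR1G).
  (* Primitivity at the larger group [R1] makes the part from [f1] zero or everything; the first is
     excluded, and the second would kill the part from [f2]. *)
  case: (IH ltR1 sR1G pR1 (c := D R1 *m f1 *m D R1)).
  - by rewrite -br1M // f11.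
  - by rewrite e1 -br1M // f1f.
  - by rewrite e1 -br1M // ff1.
  - by apply: (hom_mxM _ hD1); apply: (hom_mxM hD1); apply: hom_mxS sCN hf1.
  - by move=> e0; rewrite e0 eqxx in nz2.
  move=> ef; case/eqP: nz1.
  by rewrite /f2 mulmxBr mulmxBl -e1 ef subrr.
have Df2D : D Q *m f2 *m D Q = f2.
  have Df1 : D Q *m f1 = f1 by rewrite -{1}ff1 mulmxA Df ff1.
  have f1D : f1 *m D Q = f1 by rewrite -{1}f1f -mulmxA fD f1f.
  by rewrite /f2 mulmxBr mulmxBl DfD Df1 f1D.
have [R pQR sRN pR | z hz DzD] := brauer_lift sPG pP sQG hf2 Df2D.
  apply: contraNeq no => nz; apply/existsP; exists R.
  by rewrite pQR sRN pR nz.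
have hzQ : hom_mx Q V V z by apply: hom_mxS sQG hz.
(* The compression of the lift [z] to [M]; [E] carries endomorphisms of [M] back to the permutation
   module. *)
pose y := io *m z *m rh.
have hy : hom_mx G rM rM y by apply: hom_mxM hrh; apply: hom_mxM hio hz.
pose E (a : 'M[F]_n) := rh *m a *m io.
have hE a : hom_mx G rM rM a -> hom_mx Q V V (E a).
  by move=> ha; apply: hom_mxS sQG _; apply: hom_mxM hio; apply: hom_mxM hrh ha.
have EM a b : E (a *m y *m b) = E a *m (z *m E b) by rewrite /E /y !mulmxA.
have E1 : E 1%:M = e by rewrite /E mulmx1.
have hyl l : hom_mx G rM rM (y ^+ l).
  elim: l => [|l IHl]; first exact: hom_mx1.
  by rewrite exprSr; apply: hom_mxM IHl hy.
(* The Brauer morphism sends [z] to [f2], so every power of [y] induces the identity on the part cut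
   out by [f2]; in particular [y] is not nilpotent. *)
have DEl l : D Q *m E (y ^+ l) *m D Q *m f2 = f2.
  elim: l => [|l IHl]; first by rewrite E1.
  rewrite exprSr -[_ * y]mulmx1 EM E1 brM //; last by apply: hom_mxM hzQ heQ.
    by rewrite brM // DzD -/f -mulmxA -(mulmxA f2) ff2 f22.
  exact: hE.
have [uy | [l yl0]] := indec_fitting indM hy; last first.
  by have := DEl l; rewrite yl0 /E !(mulmx0, mul0mx) => f20; rewrite -f20 eqxx in f2n0.
have hy' : hom_mx Q V V (E (invmx y)) by apply: hE; apply: hom_mxV.
case/eqP: f1n0; rewrite -f1f.
(* Applying the Brauer morphism to [y *m invmx y = 1] shows that [f] factors through [f2], which
   [f1] annihilates. *)
have -> : f = f2 *m (D Q *m E (invmx y) *m D Q).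
  have eE : e = e *m (z *m E (invmx y)) by rewrite -{2}E1 -EM mul1mx mulmxV.
  rewrite {1}/f eE brM //; last exact: hom_mxM hzQ hy'.
  by rewrite brM // DzD -/f mulmxA ff2.
by rewrite mulmxA f12 mul0mx.
Qed.
End FullyNormalized.

Lemma gcore_trivial i x : x \in gcore P G -> to i x = i.
Proof.
move=> Ox; have [g Gg ->] := ind_act_trans i; apply/eqP.
have : x \in (P :^ g)%g.
  rewrite -(normP (subsetP (gcore_norm P G) g Gg)) in Ox.
  by apply: subsetP Ox; rewrite conjSg gcore_sub.
by rewrite -(ind_stab sPG Gg) mem_stab1 => /andP[].
Qed.

Lemma afix_join_gcore (Q : {group gT}) : Q \subset G ->
  afix to (Q <*> gcore P G)%g = afix to Q.
Proof.
move=> sQG; apply/eqP; rewrite eqEsubset afixS ?joing_subl //=.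
apply/subsetP=> i /afixP iQ.
have sQC : Q \subset ('C_G[i | to])%g.
  by apply/subsetP=> x Qx; rewrite mem_stab1 (subsetP sQG) // iQ ?eqxx.
have sOC : gcore P G \subset ('C_G[i | to])%g.
  apply/subsetP=> x Ox; rewrite mem_stab1 gcore_trivial // eqxx andbT.
  by rewrite (subsetP sPG) // (subsetP (gcore_sub P G)).
apply/afixP=> x; have : (Q <*> gcore P G \subset 'C_G[i | to])%g by rewrite join_subG sQC.
by move/subsetP/(_ x) => H /H; rewrite mem_stab1 => /andP[_ /eqP].
Qed.

Lemma scott_brauer_idem_prim :
  (forall Q : {group gT},
      gcore P G \subset Q -> Q \subset P -> fully_normalized G P Q ->
      forall m (rS : mx_representation F 'N_G(Q)%G m),
        is_scott 'N_P(Q)%G rS -> mx_indecomposable rS (Q * 'C_G(Q))%g) ->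
  forall Q : {group gT}, Q \subset G -> (p.-group Q)%g ->
    idem_prim (Q * 'C_G(Q))%g V (D Q *m e *m D Q).
Proof.
(* Descending induction on the order of [Q]. *)
move=> H2 Q; have [u] := ubnP (#|G| - #|Q|)%N.
elim: u Q => // u IHu Q ltu sQG pQ.
have IH (R : {group gT}) : (#|Q| < #|R|)%N -> R \subset G -> (p.-group R)%g ->
    idem_prim (R * 'C_G(R))%g V (D R *m e *m D R).
  move=> ltR sRG; apply: IHu => //; have leR := subset_leq_card sRG.
  by rewrite -ltnS (leq_trans _ ltu) // ltnS ltn_sub2l // (leq_trans ltR).
have sOG : gcore P G \subset G := subset_trans (gcore_sub P G) sPG.
have sKG : (Q * 'C_G(Q) \subset G)%g by rewrite mul_subG // subsetIl.
have [sOQ | nOQ] := boolP (gcore P G \subset Q); last first.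
  pose Q1 := (Q <*> gcore P G)%G.
  have nOQ' : Q \subset 'N(gcore P G)%g := subset_trans sQG (gcore_norm P G).
  have sQ1G : Q1 \subset G by rewrite join_subG sQG.
  have pQ1 : (p.-group Q1)%g.
    by rewrite /= norm_joinEl // pgroupM pQ (pgroupS (gcore_sub P G)).
  have ltQ : (#|Q| < #|Q1|)%N.
    apply: proper_card; rewrite properE joing_subl; apply: contra nOQ.
    exact: subset_trans (joing_subr _ _).
  have := IH Q1 ltQ sQ1G pQ1.
  (* [Q] and [Q1] have the same fixed points, so the idempotent is unchanged. An endomorphism over
     [Q * 'C_G(Q)] is one over [Q1 * 'C_G(Q1)], as the core acts trivially and the centralizer
     shrinks. *)
  rewrite /fix_mx [afix _ _](afix_join_gcore sQG) -/(fix_mx F to Q) => H c cc cf fc hc.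
  apply: H cc cf fc _; apply: hom_mx_mul => //; first exact: subsetIl.
    rewrite /= norm_joinEl //; apply: hom_mx_mul => //.
      by apply: hom_mxS hc; apply: mulG_subl.
    move=> x Ox; suff -> : perm_rep F to x = 1%:M by rewrite mul1mx mulmx1.
    by apply/matrixP=> i j; rewrite !mxE gcore_trivial // eq_sym.
  apply: hom_mxS hc; apply: subset_trans (mulG_subr _ _).
  by rewrite setIS // centS ?joing_subl.
(* If no conjugate of [Q] lies in [P], then [Q] has no fixed points and the Brauer quotient is 0. *)
have [/existsP[g /andP[Gg sQgP]] | no] :=
    boolP [exists g, (g \in G) && (Q :^ g \subset P)%g]; last first.
  have D0 : D Q = 0.
    apply/matrixP=> i j; have niQ : i \notin afix to Q.
      apply: contra no => /afixP iQ; have [g Gg ei] := ind_act_trans i.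
      apply/existsP; exists g^-1%g; rewrite groupV Gg sub_conjgV.
      rewrite -(ind_stab sPG Gg) -ei; apply/subsetP=> x Qx.
      by rewrite mem_stab1 (subsetP sQG) // iQ ?eqxx.
    by rewrite -[D Q]mulmx1 mul_fix_mx (negPf niQ) mxE.
  by move=> c _ cf _ _; left; rewrite -cf D0 mulmx0 mulmx0.
have [x Gx fnx] := exists_fully_normalized Gg sQgP.
have [sQxP _] := fnx.
have heQ : hom_mx Q V V e by apply: hom_mxS sQG he.
have hD : hom_mx (Q * 'C_G(Q))%g V V (D Q).
  by apply: hom_mxS (QC_sub_norm sQG) (hom_fix_mx _ _ sQG).
apply: (idem_prim_conj sKG Gx).
- by rewrite -(brauer_mulmx charF sQG sQG sQG pQ heQ heQ) ee.
- by apply: (hom_mxM _ hD); apply: (hom_mxM hD); apply: hom_mxS sKG he.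
have conjE X : V x *m X = X *m V x ->
    V x^-1%g *m (D Q *m X *m D Q) *m V x = D (Q :^ x)%g *m X *m D (Q :^ x)%g.
  move=> hX; have hDx : V x *m D (Q :^ x)%g = D Q *m V x by apply: perm_rep_fix_mx.
  rewrite -!mulmxA -hDx (mulmxA X) -hX -(mulmxA (V x)) (mulmxA (D Q)) -hDx.
  by rewrite !mulmxA perm_repVK // mul1mx.
rewrite (conjE e (he Gx)).
have -> : ((Q * 'C_G(Q)) :^ x = Q :^ x * 'C_G(Q :^ x))%g.
  by rewrite conjsMg conjIg (conjGid Gx) centJ.
pose Qx := (Q :^ x)%G.
have sOQx : gcore P G \subset Qx.
  by rewrite -(normP (subsetP (gcore_norm P G) x Gx)) conjSg.
have [m [rS scS]] := scott_exists F 'N_G(Qx)%G 'N_P(Qx)%G.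
apply: (@idem_prim_fully_normalized Qx fnx _ m rS scS (H2 Qx sOQx sQxP fnx m rS scS)).
by move=> R; rewrite /= cardJg; apply: IH.
Qed.
End ScottBrauer.

(** * Both conditions translated into primitivity of idempotents *)

Theorem theorem1p2 (k : closedFieldType) (p : nat) (gT : finGroupType)
    (G P : {group gT}) :
  prime p -> p \in [pchar k]%R ->
  P \subset G -> (p.-group P)%g ->
  saturated_FP p G P ->
  forall n (rM : mx_representation k G n), is_scott P rM ->
  (brauer_indecomposable p rM <->
   (forall Q : {group gT},
      gcore P G \subset Q -> Q \subset P -> fully_normalized G P Q ->
      forall m (rS : mx_representation k 'N_G(Q)%G m),
        is_scott 'N_P(Q)%G rS ->
        mx_indecomposable rS (Q * 'C_G(Q))%g)).
Proof.
move=> _ charF sPG pP satP n rM scM; have [indM _ _] := scM.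
have [io [rh [hio hrh io1 es]]] := scott_split scM.
split=> [bM Q _ sQP fnQ m rS scS | H2 Q sQG pQ].
  have [[m0 _] _ _] := scS; split=> //.
  have sQG := subset_trans sQP sPG; have pQ := pgroupS sQP pP.
  have sKN := QC_sub_norm sQG.
  have he := hom_mxM hrh hio.
  have ee : (rh *m io *m (rh *m io) = rh *m io)%R.
    by rewrite mulmxA -(mulmxA rh) io1 mulmx1.
  have [al [be [hal hbe ab af fb]]] := scott_summand charF sPG pP fnQ he ee es scS.
  (* [S] is a summand of [M(Q)], whose idempotent is primitive over [Q * 'C_G(Q)] by (1). *)
  apply/(idem_primP (mulmx1 _) (hom_mx1 _)).
  apply: idem_prim_summand (hom_mxS sKN hal) (hom_mxS sKN hbe) ab af fb _.
  by apply/(idem_prim_brauerP charF sQG pQ hio hrh io1 sKN); apply: bM.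
apply/(idem_prim_brauerP charF sQG pQ hio hrh io1 (QC_sub_norm sQG)).
exact: (scott_brauer_idem_prim charF sPG pP satP indM hio hrh io1 es H2 sQG pQ).
Qed.
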